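(* Let $\gamma \geq 0$ be an integer. The operad $\mathsf{Dias}_\gamma$ admits the following presentation. It is generated by $\mathfrak{G}' = \{\dashv'_a, \vdash'_a : a \in [\gamma]\}$ and its space of relations is generated by $$\dashv'_a \circ_1 \vdash'_{a'} - \vdash'_{a'} \circ_2 \dashv'_a, \qquad a, a' \in [\gamma],$$ $$\vdash'_b \circ_1 \vdash'_a, \qquad \dashv'_b \circ_2 \dashv'_a, \qquad \vdash'_b \circ_1 \dashv'_a, \qquad \dashv'_b \circ_2 \vdash'_a, \qquad a < b \in [\gamma],$$ $$\vdash'_a \circ_1 \vdash'_b - \vdash'_b \circ_2 \vdash'_a, \qquad a < b \in [\gamma],$$ $$\dashv'_b \circ_1 \dashv'_a - \dashv'_a \circ_2 \dashv'_b, \qquad a < b \in [\gamma],$$ $$\vdash'_a \circ_1 \dashv'_b - \vdash'_a \circ_2 \vdash'_b, \qquad a < b \in [\gamma],$$ $$\dashv'_a \circ_1 \dashv'_b - \dashv'_a \circ_2 \vdash'_b, \qquad a < b \in [\gamma],$$ $$\vdash'_a \circ_1 \vdash'_a - \Big(\sum_{a \leq b \in [\gamma]} \vdash'_a \circ_2 \vdash'_b\Big), \qquad a \in [\gamma],$$ $$\Big(\sum_{a \leq b \in [\gamma]} \dashv'_a \circ_1 \dashv'_b\Big) - \dashv'_a \circ_2 \dashv'_a, \qquad a \in [\gamma],$$ $$\vdash'_a \circ_1 \dashv'_a - \Big(\sum_{a \leq b \in [\gamma]} \vdash'_b \circ_2 \vdash'_a\Big), \qquad a \in [\gamma],$$ $$\Big(\sum_{a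 \leq b \in [\gamma]} \dashv'_b \circ_1 \dashv'_a\Big) - \dashv'_a \circ_2 \vdash'_a, \qquad a \in [\gamma].$$
   Context: The ground field has characteristic zero; operad means nonsymmetric operad; $[\gamma] = \{1, \dots, \gamma\}$. $\mathsf{Dias}_\gamma$ is the operad whose component of arity $n \geq 1$ is the linear span of the words of length $n$ on $\{0\} \cup [\gamma]$ with exactly one occurrence of $0$, with $u \circ_i v := u_1 \dots u_{i-1}\, \max(u_i, v_1) \dots \max(u_i, v_m)\, u_{i+1} \dots u_n$ and unit the word $0$. It is generated by the words $0a$ and $a0$, $a \in [\gamma]$; let $\mathfrak{G} = \{\dashv_a, \vdash_a : a \in [\gamma]\}$ be a set of binary symbols, where $\dashv_a$ (resp. $\vdash_a$) stands for $0a$ (resp. $a0$). $\mathbf{Free}(\mathfrak{G})$ is the free operad on $\mathfrak{G}$ (spanned by planar binary trees with internal nodes labeled by $\mathfrak{G}$). In $\mathbf{Free}(\mathfrak{G})(2)$ define $\dashv'_\gamma := \dashv_\gamma$, $\vdash'_\gamma := \vdash_\gamma$, and $\dashv'_a := \dashv_a - \dashv_{a+1}$, $\vdash'_a := \vdash_a - \vdash_{a+1}$ for $a \in [\gamma]$, $a < \gamma$. The family $\mathfrak{G}'$ of these elements is a basis of $\mathbf{Free}(\mathfrak{G})(2)$, so that $\mathbf{Free}(\mathfrak{G})$ is identified with $\mathbf{Free}(\mathfrak{G}')$. An operad $\mathcal{O}$ admits the presentation $(\mathfrak{G}', \mathfrak{R}')$ if $\mathcal{O} \cong \mathbf{Free}(\mathfrak{G}')/\langle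 \mathfrak{R}' \rangle$, where $\langle \mathfrak{R}' \rangle$ is the operad ideal generated by the subspace $\mathfrak{R}'$. *)

(* Defs.v *)
From HB Require Import structures.
From mathcomp Require Import all_boot all_order all_algebra.
From mathcomp Require Import boolp zify.

Set Implicit Arguments.
Unset Strict Implicit.
Unset Printing Implicit Defensive.

Import GRing.Theory.
Local Open Scope ring_scope.

(* Operads are nonsymmetric and have no component of arity 0.  Everywhere     *)
(* below, the index n stands for ARITY n.+1, so that grafting an element of   *)
(* index m onto one of index n gives an element of index n + m.  Inputs are   *)
(* numbered from 0: the i : 'I_n.+1 is the (i + 1)-th input.                  *)

Definition cast (X : nat -> Type) n m (e : n = m) (x : X n) : X m :=
  ecast k (X k) e x.

Record operad_axioms (X : nat -> Type) (u : X 0%N)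
    (c : forall n m, 'I_n.+1 -> X n -> X m -> X (n + m)%N) : Prop :=
  OperadAxioms {
  ax_unitl : forall m (y : X m), c 0%N m ord0 u y = y;
  ax_unitr : forall n (i : 'I_n.+1) (x : X n),
    c n 0%N i x u = cast (esym (addn0 n)) x;
  ax_seq : forall n m p (i : 'I_n.+1) (j : 'I_m.+1)
      (x : X n) (y : X m) (z : X p),
    c (n + m)%N p (inord (i + j)) (c n m i x y) z =
    cast (addnA n m p) (c n (m + p)%N i x (c m p j y z));
  ax_par : forall n m p (i k : 'I_n.+1)
      (x : X n) (y : X m) (z : X p), (i < k)%N ->
    c (n + m)%N p (inord (k + m)) (c n m i x y) z =
    cast (addnAC n p m) (c (n + p)%N m (inord i) (c n p k x z) y)
}.

Record operad (K : fieldType) := Operad {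
  component :> nat -> lmodType K;
  op_unit : component 0%N;
  op_comp : forall n m, 'I_n.+1 ->
    component n -> component m -> component (n + m)%N;
  op_linl : forall n m i (y : component m),
    linear (fun x : component n => op_comp i x y);
  op_linr : forall n m i (x : component n),
    linear (fun y : component m => op_comp i x y);
  op_ax : operad_axioms op_unit op_comp
}.

Notation "x \o1 y" := (op_comp ord0 x y) (at level 40, left associativity).
Notation "x \o2 y" := (op_comp (@inord _ 1) x y)
  (at level 40, left associativity).

Record operad_hom (K : fieldType) (O P : operad K) := OperadHom {
  hom_fun :> forall n, O n -> P n;
  hom_linear : forall n, linear (@hom_fun n);
  hom_unit : hom_fun (op_unit O) = op_unit P;
  hom_comp : forall n m (i : 'I_n.+1) (x : O n) (y : O m),
    hom_fun (op_comp i x y) = op_comp i (hom_fun x) (hom_fun y)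
}.

Definition operad_bij (K : fieldType) (O P : operad K) (f : operad_hom O P) :=
  forall n, bijective (f n).

Section Ideal.
Variables (K : fieldType) (O : operad K).

Record is_ideal (I : forall n, {pred O n}) : Prop := IsIdeal {
  ideal_sub : forall n, submod_closed (I n);
  ideal_compl : forall n m (i : 'I_n.+1) (x : O n) (y : O m),
    x \in I n -> op_comp i x y \in I (n + m)%N;
  ideal_compr : forall n m (i : 'I_n.+1) (x : O n) (y : O m),
    y \in I m -> op_comp i x y \in I (n + m)%N
}.

Record ideal := Ideal {
  ideal_pred : forall n, {pred O n};
  idealP : is_ideal ideal_pred
}.
Arguments ideal_pred _ _ : clear implicits.

Definition span_of n (A : O n -> Prop) (x : O n) : Prop :=
  forall W : {pred O n}, submod_closed W -> (forall a, A a -> a \in W) ->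
  x \in W.

Definition gen_pred k (R : O k -> Prop) n : {pred O n} :=
  fun x => `[< forall J : ideal,
    (forall r, R r -> r \in ideal_pred J k) -> x \in ideal_pred J n >].

Lemma gen_ideal_subproof k (R : O k -> Prop) : is_ideal (gen_pred R).
Proof.
split=> [n|n m i x y|n m i x y].
- split=> [|a x y].
    by apply/asboolP => J _; have [] := ideal_sub (idealP J) n.
  move=> /asboolP Jx /asboolP Jy; apply/asboolP => J RJ.
  by have [_] := ideal_sub (idealP J) n; apply; [exact: Jx|exact: Jy].
- move=> /asboolP Jx; apply/asboolP => J RJ.
  exact: (ideal_compl (idealP J) _ _ (Jx J RJ)).
- move=> /asboolP Jy; apply/asboolP => J RJ.
  exact: (ideal_compr (idealP J) _ _ (Jy J RJ)).
Qed.

Definition gen_ideal k (R : O k -> Prop) := Ideal (gen_ideal_subproof R).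

End Ideal.
Arguments ideal_pred {K O} i n _.

Section QuotientOperad.
Variables (K : fieldType) (O : operad K) (J : ideal O).

Lemma ideal_zmod_closed n : zmod_closed (ideal_pred J n).
Proof.
have [J0 JL] := ideal_sub (idealP J) n; split=> // x y Jx Jy.
by rewrite addrC -scaleN1r; apply: JL.
Qed.

HB.instance Definition _ n :=
  GRing.isZmodClosed.Build (O n) (ideal_pred J n) (ideal_zmod_closed n).

Local Open Scope quotient_scope.

Definition quot n := Quotient.quot (ideal_pred J n : zmodClosed (O n)).
HB.instance Definition _ n := GRing.Zmodule.on (quot n).

Definition quot_pi n (x : O n) : quot n := \pi_(quot n) x.

Lemma quot_piE n (x y : O n) :
  reflect (quot_pi x = quot_pi y) (x - y \in ideal_pred J n).
Proof. by rewrite Quotient.idealrBE; exact: eqP. Qed.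

Lemma quot_piD n : {morph @quot_pi n : x y / x + y}.
Proof. by move=> x y; rewrite /quot_pi Quotient.pi_add. Qed.

Lemma quot_pi_surj n (x : quot n) : exists y, x = quot_pi y.
Proof. by exists (repr x); rewrite /quot_pi reprK. Qed.

Definition quot_scale n (a : K) (x : quot n) : quot n := quot_pi (a *: repr x).

Lemma quot_piZ n a (x : O n) : quot_scale a (quot_pi x) = quot_pi (a *: x).
Proof.
have [J0 JL] := ideal_sub (idealP J) n.
apply/quot_piE; rewrite -scalerBr -[_ *: _]addr0; apply: JL => //.
by apply/quot_piE; rewrite /quot_pi reprK.
Qed.

Lemma quot_scaleA n a b (x : quot n) :
  quot_scale a (quot_scale b x) = quot_scale (a * b) x.
Proof. by have [y ->] := quot_pi_surj x; rewrite !quot_piZ scalerA. Qed.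

Lemma quot_scale1 n : left_id 1 (@quot_scale n).
Proof. by move=> x; have [y ->] := quot_pi_surj x; rewrite quot_piZ scale1r. Qed.

Lemma quot_scaleDr n : right_distributive (@quot_scale n) +%R.
Proof.
move=> a x y; have [x' ->] := quot_pi_surj x; have [y' ->] := quot_pi_surj y.
by rewrite -quot_piD !quot_piZ scalerDr quot_piD.
Qed.

Lemma quot_scaleDl n (x : quot n) :
  {morph (@quot_scale n)^~ x : a b / a + b}.
Proof.
move=> a b; have [x' ->] := quot_pi_surj x.
by rewrite !quot_piZ scalerDl quot_piD.
Qed.

HB.instance Definition _ n := GRing.Zmodule_isLmodule.Build K (quot n)
  (@quot_scaleA n) (@quot_scale1 n) (@quot_scaleDr n) (@quot_scaleDl n).

Lemma quot_pi_linear n : linear (@quot_pi n).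
Proof. by move=> a x y; rewrite quot_piD -quot_piZ. Qed.

Definition quot_comp n m (i : 'I_n.+1) (x : quot n) (y : quot m) :
  quot (n + m)%N := quot_pi (op_comp i (repr x) (repr y)).

Lemma quot_compE n m (i : 'I_n.+1) (x : O n) (y : O m) :
  quot_comp i (quot_pi x) (quot_pi y) = quot_pi (op_comp i x y).
Proof.
rewrite /quot_comp; set x' := repr _; set y' := repr _.
have Jx : x' - x \in ideal_pred J n.
  by apply/quot_piE; rewrite /quot_pi reprK.
have Jy : y' - y \in ideal_pred J m.
  by apply/quot_piE; rewrite /quot_pi reprK.
transitivity (quot_pi (op_comp i x y')); apply/quot_piE.
- have := ideal_compl (idealP J) i y' Jx.
  by rewrite addrC -scaleN1r (op_linl i y') scaleN1r addrC.
- have := ideal_compr (idealP J) i x Jy.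
  by rewrite addrC -scaleN1r (op_linr i x) scaleN1r addrC.
Qed.

Lemma quot_linl n m i (y : quot m) :
  linear (fun x : quot n => quot_comp i x y).
Proof.
move=> a x x'; have [{}x ->] := quot_pi_surj x.
have [{}x' ->] := quot_pi_surj x'; have [{}y ->] := quot_pi_surj y.
by rewrite -quot_pi_linear !quot_compE (op_linl i y) quot_pi_linear.
Qed.

Lemma quot_linr n m i (x : quot n) :
  linear (fun y : quot m => quot_comp i x y).
Proof.
move=> a y y'; have [{}x ->] := quot_pi_surj x.
have [{}y' ->] := quot_pi_surj y'; have [{}y ->] := quot_pi_surj y.
by rewrite -quot_pi_linear !quot_compE (op_linr i x) quot_pi_linear.
Qed.

Lemma cast_quot_pi n m (e : n = m) (x : O n) :
  @cast quot n m e (quot_pi x) = quot_pi (@cast (fun k => O k) n m e x).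
Proof. by case: _ / e. Qed.

Lemma quot_ax : operad_axioms (quot_pi (op_unit O)) quot_comp.
Proof.
have [ul ur sq pr] := op_ax O; split.
- by move=> m y; have [{}y ->] := quot_pi_surj y; rewrite quot_compE ul.
- move=> n i x; have [{}x ->] := quot_pi_surj x.
  by rewrite quot_compE ur cast_quot_pi.
- move=> n m p i j x y z; have [{}x ->] := quot_pi_surj x.
  have [{}y ->] := quot_pi_surj y; have [{}z ->] := quot_pi_surj z.
  by rewrite !quot_compE sq cast_quot_pi.
- move=> n m p i k x y z lt_ik; have [{}x ->] := quot_pi_surj x.
  have [{}y ->] := quot_pi_surj y; have [{}z ->] := quot_pi_surj z.
  by rewrite !quot_compE pr // cast_quot_pi.
Qed.

Definition quot_operad : operad K :=
  @Operad K (fun n => quot n : lmodType K) _ quot_comp quot_linl quot_linr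
    quot_ax.

End QuotientOperad.

Record set_operad := SetOperad {
  set_component :> nat -> finType;
  set_unit : set_component 0%N;
  set_comp : forall n m, 'I_n.+1 ->
    set_component n -> set_component m -> set_component (n + m)%N;
  set_ax : operad_axioms set_unit set_comp
}.

Section Linearization.
Variables (K : fieldType) (T : set_operad).

Definition lin n := {ffun T n -> K^o}.
HB.instance Definition _ n := Vector.on (lin n).

Definition lin_base n (t : T n) : lin n := [ffun s => (s == t)%:R].

Definition lin_comp n m (i : 'I_n.+1) (f : lin n) (g : lin m) :
    lin (n + m)%N :=
  \sum_(s : T n) \sum_(t : T m) (f s * g t) *: lin_base (set_comp i s t).

Lemma lin_baseE n (f : lin n) : f = \sum_(s : T n) f s *: lin_base s.
Proof.
apply/ffunP => t; rewrite sum_ffunE (bigD1 t) //= big1.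
  by rewrite !ffunE eqxx addr0; rewrite /GRing.scale /= mulr1.
move=> s /negPf ne; rewrite !ffunE eq_sym ne.
by rewrite /GRing.scale /= mulr0.
Qed.

Lemma lin_linl n m i (g : lin m) : linear (fun f : lin n => lin_comp i f g).
Proof.
move=> a f f'; rewrite /lin_comp scaler_sumr -big_split; apply: eq_bigr => s _.
rewrite scaler_sumr -big_split; apply: eq_bigr => t _ /=.
by rewrite !ffunE scalerA -scalerDl mulrDl mulrA.
Qed.

Lemma lin_linr n m i (f : lin n) : linear (fun g : lin m => lin_comp i f g).
Proof.
move=> a g g'; rewrite /lin_comp scaler_sumr -big_split; apply: eq_bigr => s _.
rewrite scaler_sumr -big_split; apply: eq_bigr => t _ /=.
by rewrite !ffunE scalerA -scalerDl mulrDr mulrCA.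
Qed.

Lemma lin_compE n m (i : 'I_n.+1) (s : T n) (t : T m) :
  lin_comp i (lin_base s) (lin_base t) = lin_base (set_comp i s t).
Proof.
rewrite /lin_comp (bigD1 s) //= [X in _ + X]big1 ?addr0; last first.
  move=> s' /negPf ne; rewrite big1 // => t' _.
  by rewrite !ffunE ne mul0r scale0r.
rewrite (bigD1 t) //= [X in _ + X]big1 ?addr0; last first.
  by move=> t' /negPf ne; rewrite !ffunE ne mulr0 scale0r.
by rewrite !ffunE !eqxx mulr1 scale1r.
Qed.

Lemma lin_ext n (V : lmodType K) (F G : lin n -> V) :
  linear F -> linear G -> (forall t, F (lin_base t) = G (lin_base t)) ->
  F =1 G.
Proof.
move=> linF linG FG f.
have sumE (H : lin n -> V) : linear H ->
    H f = \sum_(s : T n) f s *: H (lin_base s).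
  move=> linH.
  pose H' := HB.pack_for {linear lin n -> V} H
    (GRing.isLinear.Build K (lin n) V *:%R H linH).
  rewrite {1}(lin_baseE f) -[H]/(H' : _ -> _) linear_sum.
  by apply: eq_bigr => s _; rewrite linearZ.
by rewrite (sumE F) // (sumE G) //; apply: eq_bigr => s _; rewrite FG.
Qed.

Lemma cast_lin_base n m (e : n = m) (t : T n) :
  @cast lin n m e (lin_base t) = lin_base (@cast (fun k => T k) n m e t).
Proof. by case: _ / e. Qed.

Lemma cast_linear n m (e : n = m) : linear (@cast lin n m e).
Proof. by case: _ / e. Qed.

Lemma lin_ax : operad_axioms (lin_base (set_unit T)) lin_comp.
Proof.
have [ul ur sq pr] := set_ax T; split.
- move=> m; apply: lin_ext => [||t]; [exact: lin_linr|by []|].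
  by rewrite lin_compE ul.
- move=> n i; apply: lin_ext => [||t]; [exact: lin_linl|exact: cast_linear|].
  by rewrite lin_compE ur cast_lin_base.
- move=> n m p i j x y z; move: x; apply: lin_ext => [a f g|a f g|s].
  + by rewrite (lin_linl i) (lin_linl (inord _)).
  + by rewrite (lin_linl i) cast_linear.
  move: y; apply: lin_ext => [a f g|a f g|t].
  + by rewrite (lin_linr i) (lin_linl (inord _)).
  + by rewrite (lin_linl j) (lin_linr i) cast_linear.
  move: z; apply: lin_ext => [a f g|a f g|r].
  + by rewrite (lin_linr (inord _)).
  + by rewrite (lin_linr j) (lin_linr i) cast_linear.
  by rewrite !lin_compE sq cast_lin_base.
- move=> n m p i k x y z lt_ik; move: x.
  apply: lin_ext => [a f g|a f g|s].
  + by rewrite (lin_linl i) (lin_linl (inord _)).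
  + by rewrite (lin_linl k) (lin_linl (inord _)) cast_linear.
  move: y; apply: lin_ext => [a f g|a f g|t].
  + by rewrite (lin_linr i) (lin_linl (inord _)).
  + by rewrite (lin_linr (inord _)) cast_linear.
  move: z; apply: lin_ext => [a f g|a f g|r].
  + by rewrite (lin_linr (inord _)).
  + by rewrite (lin_linr k) (lin_linl (inord _)) cast_linear.
  by rewrite !lin_compE pr // cast_lin_base.
Qed.

Definition lin_operad : operad K :=
  @Operad K (fun n => lin n : lmodType K) _ lin_comp lin_linl lin_linr lin_ax.

End Linearization.

Section SubtypeAxioms.
Variables (D : Type) (P : nat -> pred D) (X : forall n, subType (P n)).

Lemma val_cast n m (e : n = m) (x : X n) :
  val (cast (X := fun k => X k) e x) = val x.
Proof. by case: _ / e. Qed.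

End SubtypeAxioms.

Inductive tree (S : Type) : Type := Leaf | Node of S & tree S & tree S.
Arguments Leaf {S}.

Section Trees.
Variable S : finType.

Fixpoint leaves (t : tree S) : nat :=
  if t is Node _ l r then leaves l + leaves r else 1.

Fixpoint tree_code (t : tree S) : seq (option S) :=
  if t is Node s l r then Some s :: tree_code l ++ tree_code r else [:: None].

Definition tree_step (o : option S) (st : seq (tree S)) : seq (tree S) :=
  if o is Some s then
    if st is l :: r :: st' then Node s l r :: st' else [::]
  else Leaf :: st.

Definition tree_decode (w : seq (option S)) : tree S :=
  head Leaf (foldr tree_step [::] w).

Lemma tree_codeK : cancel tree_code tree_decode.
Proof.
suff codeK t st : foldr tree_step st (tree_code t) = t :: st.
  by move=> t; rewrite /tree_decode codeK.
elim: t st => //= s l IHl r IHr st.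
by rewrite foldr_cat IHr IHl.
Qed.

HB.instance Definition _ := Countable.copy (tree S) (can_type tree_codeK).

Lemma leaves_gt0 t : (0 < leaves t)%N.
Proof. by elim: t => //= s l IHl r IHr; rewrite addn_gt0 IHl. Qed.

Lemma size_tree_code t : size (tree_code t) = (leaves t).*2.-1.
Proof.
elim: t => //= s l IHl r IHr; rewrite size_cat IHl IHr.
by have := leaves_gt0 l; have := leaves_gt0 r; lia.
Qed.

(* Graft t onto the i-th leaf (from the left, starting with 0) of s.          *)
Fixpoint graft (s : tree S) (i : nat) (t : tree S) : tree S :=
  if s is Node a l r then
    if (i < leaves l)%N then Node a (graft l i t) r
    else Node a l (graft r (i - leaves l) t)
  else t.

Lemma leaves_graft s i t : (i < leaves s)%N ->
  leaves (graft s i t) = (leaves s + leaves t).-1.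
Proof.
elim: s i => [|a l IHl r IHr] i /=; first by move=> _; lia.
have := leaves_gt0 l; have := leaves_gt0 r; have := leaves_gt0 t => ? ? ? lti.
case: ifP => lt_il /=; first by rewrite IHl //; lia.
by rewrite IHr; lia.
Qed.

Record ntree (n : nat) := NTree {
  ntree_val :> tree S;
  _ : leaves ntree_val == n.+1
}.
HB.instance Definition _ n := [isSub for @ntree_val n].
HB.instance Definition _ n := [Countable of ntree n by <:].

Lemma ntree_leaves n (t : ntree n) : leaves t = n.+1.
Proof. by apply/eqP; case: t. Qed.

Lemma ntree_code_subproof n (t : ntree n) :
  size (tree_code t) == n.*2.+1.
Proof. by rewrite size_tree_code ntree_leaves. Qed.

Definition ntree_code n (t : ntree n) : (n.*2.+1).-tuple (option S) :=
  Tuple (ntree_code_subproof t).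

Definition ntree_decode n (w : (n.*2.+1).-tuple (option S)) :
  option (ntree n) := insub (tree_decode w).

Lemma ntree_codeK n : pcancel (@ntree_code n) (@ntree_decode n).
Proof. by move=> t; rewrite /ntree_decode /= tree_codeK valK. Qed.

HB.instance Definition _ n := isFinite.Build (ntree n) (pcan_enumP (@ntree_codeK n)).

Lemma ngraft_subproof n m (i : 'I_n.+1) (s : ntree n) (t : ntree m) :
  leaves (graft s i t) == (n + m).+1.
Proof. by rewrite leaves_graft ntree_leaves // ntree_leaves addSn addnS. Qed.

Definition ngraft n m (i : 'I_n.+1) (s : ntree n) (t : ntree m) :
  ntree (n + m) := NTree (ngraft_subproof i s t).

Definition nleaf : ntree 0 := @NTree 0 Leaf isT.

Lemma graft_seq s t r i j : (i < leaves s)%N -> (j < leaves t)%N ->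
  graft (graft s i t) (i + j) r = graft s i (graft t j r).
Proof.
elim: s i => [|a s1 IH1 s2 IH2] i /=; first by case: i.
have := leaves_gt0 s1 => ? lti ltj.
case: ifP => lt_i /=.
  rewrite leaves_graft // IH1 //.
  by have -> : (i + j < (leaves s1 + leaves t).-1)%N by lia.
have -> : (i + j < leaves s1)%N = false by lia.
have -> : (i + j - leaves s1 = i - leaves s1 + j)%N by lia.
by rewrite IH2 //; lia.
Qed.

Lemma graft_par s t r i k : (i < k)%N -> (k < leaves s)%N ->
  graft (graft s i t) (k + (leaves t).-1) r = graft (graft s k r) i t.
Proof.
have := leaves_gt0 t => lt0.
have := leaves_gt0 r => lr0.
elim: s i k => [|a s1 IH1 s2 IH2] i k ltik /= ltk; first by lia.
case: (ltnP k (leaves s1)) => ltk1.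
  have lti1 : (i < leaves s1)%N by lia.
  rewrite lti1 /= !leaves_graft //.
  have -> : (k + (leaves t).-1 < (leaves s1 + leaves t).-1)%N by lia.
  have -> : (i < (leaves s1 + leaves r).-1)%N by lia.
  by rewrite IH1.
case: (ltnP i (leaves s1)) => lti1 /=.
  rewrite leaves_graft // lti1.
  have -> : (k + (leaves t).-1 < (leaves s1 + leaves t).-1)%N = false by lia.
  by congr (Node _ _ (graft _ _ _)); lia.
have -> : (k + (leaves t).-1 < leaves s1)%N = false by lia.
have -> : (i < leaves s1)%N = false by lia.
rewrite -IH2; [|lia|lia].
by congr (Node _ _ (graft _ _ _)); lia.
Qed.

Lemma tree_ax : operad_axioms nleaf ngraft.
Proof.
split.
- by move=> m y; apply: val_inj.
- move=> n i x; apply: val_inj; rewrite val_cast /=.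
  by elim: (ntree_val x) (nat_of_ord i) => //= a l IHl r IHr k;
    rewrite IHl IHr; case: ifP.
- move=> n m p i j x y z; apply: val_inj; rewrite val_cast /=.
  by rewrite inordK ?graft_seq ?ntree_leaves //; have := ltn_ord i;
     have := ltn_ord j; lia.
- move=> n m p i k x y z ltik; apply: val_inj; rewrite val_cast /=.
  rewrite !inordK; try by have := ltn_ord i; have := ltn_ord k; lia.
  by have := @graft_par x y z i k ltik; rewrite !ntree_leaves => ->.
Qed.

Definition tree_operad : set_operad :=
  @SetOperad (fun n => ntree n : finType) nleaf ngraft tree_ax.

Definition corolla (s : S) : tree_operad 1%N := @NTree 1 (Node s Leaf Leaf) isT.

End Trees.

Definition free_operad (K : fieldType) (S : finType) : operad K :=
  lin_operad K (tree_operad S).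

Definition free_gen (K : fieldType) (S : finType) (s : S) :
    free_operad K S 1%N := lin_base K (corolla s).

Section Words.
Variable g : nat.

(* Words of length n.+1 on the alphabet {0, ..., g} with exactly one 0.       *)
Record word (n : nat) := Word {
  word_val :> seq 'I_g.+1;
  _ : (size word_val == n.+1) && (count_mem ord0 word_val == 1%N)
}.
HB.instance Definition _ n := [isSub for @word_val n].
HB.instance Definition _ n := [Countable of word n by <:].

Lemma word_size n (w : word n) : size w = n.+1.
Proof. by case: w => w /= /andP[/eqP]. Qed.

Lemma word_count n (w : word n) : count_mem ord0 w = 1%N.
Proof. by case: w => w /= /andP[_ /eqP]. Qed.

Definition word_tuple n (w : word n) : (n.+1).-tuple 'I_g.+1 :=
  Tuple (introT eqP (word_size w)).

Definition tuple_word n (w : (n.+1).-tuple 'I_g.+1) : option (word n) :=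
  insub (val w).

Lemma word_tupleK n : pcancel (@word_tuple n) (@tuple_word n).
Proof. by move=> w; rewrite /tuple_word /= valK. Qed.

HB.instance Definition _ n := isFinite.Build (word n) (pcan_enumP (@word_tupleK n)).

Definition lmax (a b : 'I_g.+1) : 'I_g.+1 := if (a <= b)%N then b else a.

(* The letter of u at position i (starting with 0) is replaced by the letters *)
(* of v, each of them joined with it by max.                                  *)
Definition word_comp (u : seq 'I_g.+1) (i : nat) (v : seq 'I_g.+1) :=
  take i u ++ [seq lmax (nth ord0 u i) b | b <- v] ++ drop i.+1 u.


Lemma lmaxA : associative lmax.
Proof.
by move=> a b c; apply: val_inj; rewrite /lmax; do ![case: ifP => //=]; lia.
Qed.

Lemma lmax0l : left_id ord0 lmax.
Proof. by []. Qed.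

Lemma lmax_eq0 a b : (lmax a b == ord0) = (a == ord0) && (b == ord0).
Proof. by rewrite -!val_eqE /lmax; case: ifP => /=; lia. Qed.

Lemma word_comp_cat u1 a u2 i v : size u1 = i ->
  word_comp (u1 ++ a :: u2) i v = u1 ++ map (lmax a) v ++ u2.
Proof.
move=> <-; rewrite /word_comp take_size_cat // nth_cat ltnn subnn /=.
congr (_ ++ (_ ++ _)).
by rewrite drop_cat ltnNge leqnSn /= subSn ?subnn //= drop0.
Qed.

Lemma seq_split (u : seq 'I_g.+1) i : (i < size u)%N ->
  exists u1 a u2, u = u1 ++ a :: u2 /\ size u1 = i.
Proof.
move=> lti; exists (take i u), (nth ord0 u i), (drop i.+1 u).
by rewrite -drop_nth // cat_take_drop size_takel // ltnW.
Qed.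

Lemma nword_comp_subproof n m (i : 'I_n.+1) (u : word n) (v : word m) :
  (size (word_comp u i v) == (n + m).+1) &&
  (count_mem ord0 (word_comp u i v) == 1%N).
Proof.
have lti : (i < size u)%N by rewrite word_size.
have := word_count u; have := word_size u.
have := word_count v; have := word_size v.
have [u1 [a [u2 [-> su1]]]] := seq_split lti.
rewrite (word_comp_cat _ _ _ su1) !size_cat !count_cat size_map /= => sv cv su.
have -> : count_mem ord0 (map (lmax a) v) =
          if a == ord0 then count_mem ord0 v else 0%N.
  rewrite count_map; case: ifP => a0.
    by apply: eq_count => b /=; rewrite lmax_eq0 a0.
  rewrite (@eq_count _ _ pred0) ?count_pred0 // => b /=.
  by rewrite lmax_eq0 a0.
by rewrite cv; case: (a == ord0) => /= cu; lia.
Qed.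

Definition nword_comp n m (i : 'I_n.+1) (u : word n) (v : word m) :
  word (n + m) := Word (nword_comp_subproof i u v).

Definition word_unit : word 0 := @Word 0 [:: ord0] isT.

Lemma word_ax : operad_axioms word_unit nword_comp.
Proof.
split.
- move=> m y; apply: val_inj; rewrite /= /word_comp /= cats0.
  by rewrite (eq_map lmax0l) map_id.
- move=> n i x; apply: val_inj; rewrite val_cast /=.
  have lti : (i < size x)%N by rewrite word_size.
  have [u1 [a [u2 [-> su1]]]] := seq_split lti.
  rewrite (word_comp_cat _ _ _ su1) /=; congr (_ ++ _ :: _).
  by apply: val_inj; rewrite /lmax; case: ifP => //=; lia.
- move=> n m p i j x y z; apply: val_inj; rewrite val_cast /=.
  rewrite inordK; last by have := ltn_ord i; have := ltn_ord j; lia.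
  have lti : (i < size x)%N by rewrite word_size.
  have ltj : (j < size y)%N by rewrite word_size.
  have [u1 [a [u2 [-> su1]]]] := seq_split lti.
  have [v1 [b [v2 [-> sv1]]]] := seq_split ltj.
  rewrite !(word_comp_cat _ _ _ su1) !(word_comp_cat _ _ _ sv1).
  rewrite map_cat /= -catA catA word_comp_cat ?size_cat ?size_map ?su1 ?sv1 //.
  rewrite !map_cat -!catA -map_comp; congr (_ ++ (_ ++ (_ ++ _))).
  by apply: eq_map => c /=; rewrite lmaxA.
- move=> n m p i k x y z ltik; apply: val_inj; rewrite val_cast /=.
  rewrite !inordK; try by have := ltn_ord i; have := ltn_ord k; lia.
  have ltk : (k < size x)%N by rewrite word_size.
  have sy := word_size y.
  have [u1 [a [u2 [-> su1]]]] := seq_split ltk.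
  have lti : (i < size u1)%N by rewrite su1.
  have [v1 [b [v2 [eu1 sv1]]]] := seq_split lti; subst u1.
  rewrite (word_comp_cat _ _ _ su1) -!catA /= !(word_comp_cat _ _ _ sv1).
  rewrite !catA word_comp_cat -?catA //.
  by move: su1; rewrite !size_cat size_map sy /=; lia.
Qed.

Definition word_operad : set_operad :=
  @SetOperad (fun n => word n : finType) word_unit nword_comp word_ax.

(* The letter a of the alphabet [g] is the ordinal a - 1 : 'I_g.              *)
Lemma word2l_subproof (a : 'I_g) :
  (size [:: ord0; lift ord0 a] == 2%N) &&
  (count_mem ord0 [:: ord0; lift ord0 a] == 1%N).
Proof. by []. Qed.

Lemma word2r_subproof (a : 'I_g) :
  (size [:: lift ord0 a; ord0] == 2%N) &&
  (count_mem ord0 [:: lift ord0 a; ord0] == 1%N).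
Proof. by []. Qed.

Definition word2l (a : 'I_g) : word_operad 1%N := @Word 1 _ (word2l_subproof a).
Definition word2r (a : 'I_g) : word_operad 1%N := @Word 1 _ (word2r_subproof a).

End Words.

Definition dias (K : fieldType) (g : nat) : operad K :=
  lin_operad K (word_operad g).

(* The symbol inl a is the left product of index a, to be read as the word    *)
(* 0a; the symbol inr a is the right product of index a, read as a0.          *)
Definition dias_symbol (g : nat) : finType := ('I_g + 'I_g)%type.

Definition dias_gen (K : fieldType) (g : nat) (s : dias_symbol g) :
    dias K g 1%N :=
  lin_base K (match s with inl a => word2l a | inr a => word2r a end).

Section Primed.
Variables (K : fieldType) (g : nat).

Local Notation F := (free_operad K (dias_symbol g)).

Definition left_gen (a : 'I_g) : F 1%N := free_gen K (inl a : dias_symbol g).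
Definition right_gen (a : 'I_g) : F 1%N := free_gen K (inr a : dias_symbol g).

(* insub a.+1 is None exactly when a is the last index.                       *)
Definition lp (a : 'I_g) : F 1%N :=
  if insub a.+1 is Some b then left_gen a - left_gen b else left_gen a.
Definition rp (a : 'I_g) : F 1%N :=
  if insub a.+1 is Some b then right_gen a - right_gen b else right_gen a.

Definition primed (s : dias_symbol g) : F 1%N :=
  match s with inl a => lp a | inr a => rp a end.

Inductive primed_relator : F 2%N -> Prop :=
| rel_lr (a a' : 'I_g) :
    primed_relator (lp a \o1 rp a' - rp a' \o2 lp a)
| rel_r1r0 (a b : 'I_g) : (a < b)%N -> primed_relator (rp b \o1 rp a)
| rel_l2l0 (a b : 'I_g) : (a < b)%N -> primed_relator (lp b \o2 lp a)
| rel_r1l0 (a b : 'I_g) : (a < b)%N -> primed_relator (rp b \o1 lp a)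
| rel_l2r0 (a b : 'I_g) : (a < b)%N -> primed_relator (lp b \o2 rp a)
| rel_rr (a b : 'I_g) : (a < b)%N ->
    primed_relator (rp a \o1 rp b - rp b \o2 rp a)
| rel_ll (a b : 'I_g) : (a < b)%N ->
    primed_relator (lp b \o1 lp a - lp a \o2 lp b)
| rel_r1l (a b : 'I_g) : (a < b)%N ->
    primed_relator (rp a \o1 lp b - rp a \o2 rp b)
| rel_l2r (a b : 'I_g) : (a < b)%N ->
    primed_relator (lp a \o1 lp b - lp a \o2 rp b)
| rel_sum_r (a : 'I_g) :
    primed_relator
      (rp a \o1 rp a - \sum_(b < g | (a <= b)%N) rp a \o2 rp b)
| rel_sum_l (a : 'I_g) :
    primed_relator
      (\sum_(b < g | (a <= b)%N) lp a \o1 lp b - lp a \o2 lp a)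
| rel_sum_rl (a : 'I_g) :
    primed_relator
      (rp a \o1 lp a - \sum_(b < g | (a <= b)%N) rp b \o2 rp a)
| rel_sum_lr (a : 'I_g) :
    primed_relator
      (\sum_(b < g | (a <= b)%N) lp b \o1 lp a - lp a \o2 rp a).

End Primed.

(* (G, R) presents O, where G is a family of elements of arity 2 of the free  *)
(* operad on the binary symbols S and R a set of elements of arity 3 of it:   *)
(* G is a basis of the space of arity 2, so that the free operad on S is the  *)
(* free operad on G, and O is isomorphic to the quotient of that operad by    *)
(* the ideal generated by the span of R. Each symbol s is required to         *)
(* correspond to the element interp s of O it stands for.                     *)
Definition admits_presentation (K : fieldType) (O : operad K) (S : finType)
    (interp : S -> O 1%N) (G : seq (lin K (tree_operad S) 1%N))
    (R : free_operad K S 2%N -> Prop) : Prop :=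
  basis_of fullv G /\
  exists f : operad_hom (quot_operad (gen_ideal (span_of R))) O,
    operad_bij f /\
    forall s, f 1%N (quot_pi (gen_ideal (span_of R)) (free_gen K s)) = interp s.

(* Main.v *)
(* The words l a := 0a and r a := a0 are the telescoping sums of the primed
   generators of index at least a, so a primed relation is a statement about
   double differences of the arrays (a, b) |-> r a \o1 r b, etc. Summing them
   back by descending induction on the indices shows that, in any operad, the
   primed relations are equivalent to
     l a \o1 r b = r b \o2 l a,
     r a \o1 r b = r (max a b) \o2 r a,  r a \o1 l b = r a \o2 r (max a b),
     l a \o2 l b = l (max a b) \o1 l a,  l a \o2 r b = l a \o1 l (max a b).
   These hold in Dias, and read from left to right they rewrite every tree into
   a right comb of r's ending with a left comb of l's. Such normal forms are in
   bijection with the words with exactly one 0. *)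
From HB Require Import structures.
Require Import Defs.
From mathcomp Require Import all_boot all_order all_algebra.
From mathcomp Require Import boolp zify.

Set Implicit Arguments.
Unset Strict Implicit.
Unset Printing Implicit Defensive.

Import GRing.Theory.
Local Open Scope ring_scope.

(** * Linearity of maps and of operadic composition *)

Section LinearFunctions.
Variables (K : fieldType) (U V : lmodType K) (F : U -> V).
Hypothesis linF : linear F.

Let F' : {linear U -> V} :=
  HB.pack_for {linear U -> V} F (GRing.isLinear.Build K U V *:%R F linF).

Lemma lin_map0 : F 0 = 0. Proof. exact: (linear0 F'). Qed.

Lemma lin_mapB x y : F (x - y) = F x - F y. Proof. exact: (linearB F'). Qed.

Lemma lin_map_sum (I : finType) (P : pred I) (f : I -> U) :
  F (\sum_(i | P i) f i) = \sum_(i | P i) F (f i).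
Proof. exact: (linear_sum F'). Qed.

End LinearFunctions.

Section CompositionLinearity.
Variables (K : fieldType) (P : operad K) (n m : nat) (i : 'I_n.+1).
Implicit Types (x : P n) (y : P m).

Lemma comp0l y : op_comp i 0 y = 0.
Proof. exact: (lin_map0 (op_linl i y)). Qed.

Lemma comp0r x : op_comp i x (0 : P m) = 0.
Proof. exact: (lin_map0 (op_linr i x)). Qed.

Lemma compBl x x' y : op_comp i (x - x') y = op_comp i x y - op_comp i x' y.
Proof. exact: (lin_mapB (op_linl i y)). Qed.

Lemma compBr x y y' : op_comp i x (y - y') = op_comp i x y - op_comp i x y'.
Proof. exact: (lin_mapB (op_linr i x)). Qed.

Lemma comp_suml (I : finType) (Q : pred I) (f : I -> P n) y :
  op_comp i (\sum_(k | Q k) f k) y = \sum_(k | Q k) op_comp i (f k) y.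
Proof. exact: (lin_map_sum (op_linl i y)). Qed.

Lemma comp_sumr (I : finType) (Q : pred I) x (f : I -> P m) :
  op_comp i x (\sum_(k | Q k) f k) = \sum_(k | Q k) op_comp i x (f k).
Proof. exact: (lin_map_sum (op_linr i x)). Qed.

End CompositionLinearity.

(** * Kernels of operad morphisms and factorization through a quotient *)

Section OperadHoms.
Variables (K : fieldType) (O P : operad K) (h : operad_hom O P).

Lemma hom0 n : h n 0 = 0. Proof. exact: (lin_map0 (@hom_linear _ _ _ h n)). Qed.

Lemma homB n x y : h n (x - y) = h n x - h n y.
Proof. exact: (lin_mapB (@hom_linear _ _ _ h n)). Qed.

Lemma hom_sum n (I : finType) (Q : pred I) (f : I -> O n) :
  h n (\sum_(k | Q k) f k) = \sum_(k | Q k) h n (f k).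
Proof. exact: (lin_map_sum (@hom_linear _ _ _ h n)). Qed.

(** This is [hom_comp] with the index [2] in place of the convertible [1 + 1], the form in which
    relators present themselves to [rewrite]. *)
Lemma hom_comp11 (i : 'I_2) (x y : O 1%N) :
  h 2 (op_comp i x y) = op_comp i (h 1%N x) (h 1%N y).
Proof. exact: hom_comp. Qed.

Definition ker_pred n : {pred O n} := fun x => h n x == 0.

Lemma ker_is_ideal : is_ideal ker_pred.
Proof.
split=> [n|n m i x y|n m i x y].
- split=> [|a x y]; first by rewrite unfold_in hom0.
  rewrite !unfold_in => /eqP hx /eqP hy.
  by rewrite (@hom_linear _ _ _ h) hx hy scaler0 addr0.
- by rewrite !unfold_in hom_comp => /eqP ->; rewrite comp0l.
- by rewrite !unfold_in hom_comp => /eqP ->; rewrite comp0r.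
Qed.

Definition ker_ideal := Ideal ker_is_ideal.

(** The kernel of [h] is one of the ideals quantified over in [gen_pred]; being a subspace in each
    arity, it contains the span of [R] as soon as it contains [R]. *)
Lemma gen_ideal_ker k (R : O k -> Prop) :
  (forall r, R r -> h k r = 0) ->
  forall n (x : O n), x \in ideal_pred (gen_ideal (span_of R)) n -> h n x = 0.
Proof.
move=> hR n x /asboolP/(_ ker_ideal) hx; apply/eqP; apply: hx => r Rr.
apply: Rr; first exact: (ideal_sub ker_is_ideal).
by move=> a /hR ra; rewrite unfold_in ra.
Qed.

Section Lift.
Variable J : ideal O.
Hypothesis Jker : forall n (x : O n), x \in ideal_pred J n -> h n x = 0.

Definition quot_lift_fun n (q : quot J n) : P n := h n (repr q).

(** Independence of the representative: [repr] returns an element differing from [x] by a member of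
    [J], which [h] kills. *)
Lemma quot_lift_pi n (x : O n) : quot_lift_fun (quot_pi J x) = h n x.
Proof.
apply/eqP; rewrite -subr_eq0 /quot_lift_fun -homB; apply/eqP/Jker.
by apply/quot_piE; rewrite /quot_pi generic_quotient.reprK.
Qed.

Lemma quot_lift_linear n : linear (@quot_lift_fun n).
Proof.
move=> a x y; have [{}x ->] := quot_pi_surj x.
have [{}y ->] := quot_pi_surj y.
by rewrite -quot_pi_linear !quot_lift_pi hom_linear.
Qed.

Lemma quot_lift_comp n m (i : 'I_n.+1) (x : quot J n) (y : quot J m) :
  quot_lift_fun (quot_comp i x y) =
  op_comp i (quot_lift_fun x) (quot_lift_fun y).
Proof.
have [{}x ->] := quot_pi_surj x; have [{}y ->] := quot_pi_surj y.
by rewrite quot_compE !quot_lift_pi hom_comp.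
Qed.

Lemma quot_lift_unit : quot_lift_fun (quot_pi J (op_unit O)) = op_unit P.
Proof. by rewrite quot_lift_pi hom_unit. Qed.

Definition quot_lift : operad_hom (quot_operad J) P :=
  @OperadHom K (quot_operad J) P quot_lift_fun quot_lift_linear
    quot_lift_unit quot_lift_comp.

End Lift.
End OperadHoms.

Lemma relator_gen_ideal (K : fieldType) (O : operad K) k (R : O k -> Prop) r :
  R r -> quot_pi (gen_ideal (span_of R)) r = 0.
Proof.
move=> Rr; rewrite -[RHS](lin_map0 (@quot_pi_linear _ _ _ k)).
apply/quot_piE; rewrite subr0; apply/asboolP => J; apply.
by move=> W _; apply.
Qed.

Definition quot_hom (K : fieldType) (O : operad K) (J : ideal O) :
    operad_hom O (quot_operad J) :=
  @OperadHom K O (quot_operad J) (@quot_pi K O J) (@quot_pi_linear K O J)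
    erefl (fun n m i x y => esym (quot_compE J i x y)).

(** * Linear extension from a basis, and linearized morphisms of set operads *)

Section LinearLift.
Variables (K : fieldType) (T : set_operad).

Definition lin_lift n (V : lmodType K) (f : T n -> V) (x : lin K T n) : V :=
  \sum_(t : T n) x t *: f t.

Lemma lin_lift_linear n (V : lmodType K) (f : T n -> V) : linear (lin_lift f).
Proof.
move=> a x y; rewrite /lin_lift scaler_sumr -big_split; apply: eq_bigr => t _.
by rewrite /= !ffunE -[a *: x t]/(a * x t) scalerDl scalerA.
Qed.

Lemma lin_lift_base n (V : lmodType K) (f : T n -> V) t :
  lin_lift f (lin_base K t) = f t.
Proof.
rewrite /lin_lift (bigD1 t) //= big1 ?addr0 => [|s /negPf ne].
  by rewrite ffunE eqxx scale1r.
by rewrite ffunE ne scale0r.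
Qed.

Variable U : set_operad.
Variable phi : forall n, T n -> U n.
Arguments phi {n}.
Hypothesis phi_unit : phi (set_unit T) = set_unit U.
Hypothesis phi_comp : forall n m (i : 'I_n.+1) (s : T n) (t : T m),
  phi (set_comp i s t) = set_comp i (phi s) (phi t).

Definition linearize_fun n : lin K T n -> lin K U n :=
  lin_lift (fun t => lin_base K (phi t)).

Lemma linearize_fun_linear n : linear (@linearize_fun n).
Proof. exact: lin_lift_linear. Qed.

Lemma linearize_unit :
  linearize_fun (lin_base K (set_unit T)) = lin_base K (set_unit U).
Proof. by rewrite /linearize_fun lin_lift_base phi_unit. Qed.

Lemma linearize_comp n m (i : 'I_n.+1) (x : lin K T n) (y : lin K T m) :
  linearize_fun (lin_comp i x y) =
  lin_comp i (linearize_fun x) (linearize_fun y).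
Proof.
move: x; apply: lin_ext => [a f g|a f g|s].
- by rewrite (lin_linl i) linearize_fun_linear.
- by rewrite linearize_fun_linear (lin_linl i).
move: y; apply: lin_ext => [a f g|a f g|t].
- by rewrite (lin_linr i) linearize_fun_linear.
- by rewrite linearize_fun_linear (lin_linr i).
by rewrite /linearize_fun !lin_compE !lin_lift_base lin_compE phi_comp.
Qed.

Definition linearize : operad_hom (lin_operad K T) (lin_operad K U) :=
  @OperadHom K (lin_operad K T) (lin_operad K U) linearize_fun
    linearize_fun_linear linearize_unit linearize_comp.

Lemma linearize_base n (t : T n) :
  linearize n (lin_base K t) = lin_base K (phi t).
Proof. exact: lin_lift_base. Qed.

End LinearLift.

(** * Double differences of arrays vanishing from index [g] on *)

Section DoubleDifferences.
Variables (V : zmodType) (g : nat) (X Y : nat -> nat -> V).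
Hypothesis X0 : forall a b, (g <= a)%N || (g <= b)%N -> X a b = 0.
Hypothesis Y0 : forall a b, (g <= a)%N || (g <= b)%N -> Y a b = 0.

(** When [Z a b] is bilinear in terms [x a] and [y b], this is the same expression in [x a - x a.+1]
    and [y b - y b.+1], that is, in primed generators. *)
Definition dd (Z : nat -> nat -> V) a b :=
  Z a b - Z a.+1 b - (Z a b.+1 - Z a.+1 b.+1).

(** Above the diagonal the four entries involved are those of [Y]. Below it, [X a b = Y a a] does
    not depend on [b]. On it, the two entries of row [a.+1] cancel. *)
Lemma dd_of_max : (forall a b, X a b = Y a (maxn a b)) ->
  [/\ forall a b, (a < b)%N -> dd X a b = dd Y a b,
      forall a b, (b < a)%N -> dd X a b = 0
    & forall a, dd X a a = Y a a - Y a a.+1].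
Proof.
move=> XY; split=> [a b ab|a b ba|a]; rewrite /dd !XY.
- by rewrite !(maxn_idPr _) ?leqW // ltnW.
- by rewrite !(maxn_idPl _) ?subrr ?leqW // ltnW.
- by rewrite !maxnn (maxn_idPr (leqnSn a)) (maxn_idPl (leqnSn a)) opprB addrA
    subrK.
Qed.

(** The boundary zeros at [g] allow the double differences to be integrated back, first off the
    diagonal, then along it. *)
Lemma max_of_dd :
  (forall a b, (a < b < g)%N -> dd X a b = dd Y a b) ->
  (forall a b, (b < a < g)%N -> dd X a b = 0) ->
  (forall a, (a < g)%N -> dd X a a = Y a a - Y a a.+1) ->
  forall a b, X a b = Y a (maxn a b).
Proof.
move=> ddlt ddgt ddeq.
have down (Q : nat -> Prop) : (forall a, (g <= a)%N -> Q a) ->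
    (forall a, (a < g)%N -> Q a.+1 -> Q a) -> forall a, Q a.
  move=> Qg QS a; have [k] := ubnP (g - a); elim: k a => // k IH a lt_k.
  by case: (leqP g a) => [/Qg //|lt_a]; apply: QS => //; apply: IH; lia.
(* Below the diagonal a zero double difference says that [X a b - X a b.+1] equals the same
   difference in row [a.+1], which is zero by induction. *)
have Xgt a b : (b < a)%N -> X a b = X a b.+1.
  move: a b; apply: (down (fun a => forall b, _)) => [a ga b _|a ag IH b ba].
    by rewrite !X0 ?ga.
  have := ddgt a b; rewrite ba ag => /(_ isT).
  by rewrite /dd -IH ?leqW // opprB addrA subrK => /eqP; rewrite subr_eq0 => /eqP.
(* Above the diagonal only the outer difference, in [b], can be summed yet: the inner one leads to
   the diagonal, whose values are still unknown. *)
have Xlt a b : (a < b)%N -> X a b - X a.+1 b = Y a b - Y a.+1 b.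
  move: b a; apply: (down (fun b => forall a, _)) => [b gb a _|b bg IH a ab].
    by rewrite !X0 ?Y0 ?gb ?orbT.
  have := ddlt a b; rewrite ab bg => /(_ isT); rewrite /dd IH ?leqW //.
  exact: addIr.
have Xdiag : forall a, X a a = Y a a.
  apply: down => [a ga|a ag IH]; first by rewrite X0 ?Y0 ?ga.
  have := ddeq a ag; rewrite /dd (Xlt a a.+1) // (Xgt a.+1 a) // IH.
  by rewrite opprB addrA subrK => /addIr.
(* Entries on or above the diagonal are reached from [X b b] by going up [k] rows in column [b];
   those below are carried along their row to the diagonal by [Xgt]. *)
suff Xle k b : X (b - k)%N b = Y (b - k)%N b.
  move=> a b; case: (leqP a b) => [ab|ba].
    by rewrite -(subKn ab) Xle.
  rewrite -Xdiag; have -> : b = (a - (a - b))%N by lia.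
  have: (0 < a - b <= a)%N by lia.
  elim: (a - b)%N => // k IH /andP[_ ka].
  case: k IH ka => [|k] IH ka; rewrite Xgt; try lia.
    by congr (X _ _); lia.
  by rewrite -IH; [congr (X _ _); lia|lia].
elim: k => [|k IH]; first by rewrite subn0 Xdiag.
(* Subtraction is truncated: once [k] reaches [b], the row index stays at 0. *)
case: (leqP b k) => bk; first by rewrite (_ : b - k.+1 = b - k)%N //; lia.
have e : (b - k = (b - k.+1).+1)%N by lia.
have := @Xlt (b - k.+1)%N b; rewrite -e IH => /(_ _)/addIr; apply; lia.
Qed.

End DoubleDifferences.

Section ZeroExtension.
Variables (g : nat) (V : zmodType) (f : 'I_g -> V).

Definition omax (a b : 'I_g) : 'I_g := if (a <= b)%N then b else a.

Lemma val_omax a b : omax a b = maxn a b :> nat.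
Proof. by rewrite /omax; case: leqP. Qed.

(** Extending by zero makes the last primed generator, from which nothing is subtracted, a
    difference of consecutive terms like the others. *)
Definition ext0 (k : nat) : V := if insub k is Some a then f a else 0.

Lemma ext0_ord (a : 'I_g) : ext0 a = f a.
Proof. by rewrite /ext0 valK. Qed.

Lemma ext0_out k : (g <= k)%N -> ext0 k = 0.
Proof. by move=> gk; rewrite /ext0 insubF // ltnNge gk. Qed.

(** For zero extensions this inverts the passage from unprimed to primed generators. *)
Lemma sum_telescope_out (u : nat -> V) a : (a <= g)%N -> u g = 0 ->
  \sum_(b < g | (a <= b)%N) (u b - u b.+1) = u a.
Proof.
move=> ag ug; rewrite -(big_geq_mkord _ _ xpredT (fun b => u b - u b.+1)).
under eq_bigr do rewrite -opprB.
by rewrite sumrN telescope_sumr // ug sub0r opprK.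
Qed.

End ZeroExtension.

Section MaxDifferences.
Variables (g : nat) (V : zmodType) (X Y : nat -> nat -> V).
Hypothesis X0 : forall a b, (g <= a)%N || (g <= b)%N -> X a b = 0.
Hypothesis Y0 : forall a b, (g <= a)%N || (g <= b)%N -> Y a b = 0.

(** Out of range both sides vanish, so the identity on ordinals extends to all naturals, where the
    two implications on [dd] apply. *)
Lemma max_ddP :
  (forall a b : 'I_g, X a b = Y a (omax a b)) <->
  [/\ forall a b : 'I_g, (a < b)%N -> dd X a b = dd Y a b,
      forall a b : 'I_g, (a < b)%N -> dd X b a = 0
    & forall a : 'I_g, dd X a a = Y a a - Y a a.+1].
Proof.
split=> [XY|[ddlt ddgt ddeq] a b].
  suff /dd_of_max[ddlt ddgt ddeq] : forall a b, X a b = Y a (maxn a b).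
    by split=> *; auto.
  move=> a b.
  case: (leqP g a) => [ga|ag]; first by rewrite X0 ?Y0 ?ga.
  case: (leqP g b) => [gb|bg]; first by rewrite X0 ?Y0 ?leq_max ?gb ?orbT.
  by have := XY (Ordinal ag) (Ordinal bg); rewrite val_omax.
rewrite val_omax.
apply: (max_of_dd X0 Y0) => [c d /andP[cd dg]|c d /andP[dc cg]|c cg].
- exact: (ddlt (Ordinal (ltn_trans cd dg)) (Ordinal dg)).
- exact: (ddgt (Ordinal (ltn_trans dc cg)) (Ordinal cg)).
- exact: (ddeq (Ordinal cg)).
Qed.

End MaxDifferences.

(** * Equivalence of the primed and unprimed relations in an arbitrary operad *)

Section Pluriassociativity.
Variables (K : fieldType) (g : nat) (P : operad K).

Section Families.
Variables s d t e : 'I_g -> P 1%N.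
Hypothesis dE : forall a : 'I_g, d a = ext0 s a - ext0 s a.+1.
Hypothesis eE : forall a : 'I_g, e a = ext0 t a - ext0 t a.+1.

Lemma ext0_comp_out i (u v : 'I_g -> P 1%N) a b : (g <= a)%N || (g <= b)%N ->
  op_comp i (ext0 u a) (ext0 v b) = 0.
Proof.
by case/orP => out; [rewrite (ext0_out _ out) comp0l|
                     rewrite [ext0 v b]ext0_out // comp0r].
Qed.

Lemma sum_differences (a : 'I_g) : \sum_(b < g | (a <= b)%N) d b = s a.
Proof.
under eq_bigr do rewrite dE.
by rewrite sum_telescope_out ?(ltnW (ltn_ord a)) ?ext0_ord // ext0_out.
Qed.

Lemma dd_comp i (u v : nat -> P 1%N) a b :
  dd (fun a b => op_comp i (u a) (v b)) a b =
  op_comp i (u a - u a.+1) (v b - v b.+1).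
Proof. by rewrite compBr !compBl. Qed.

Lemma dd_compC i (u v : nat -> P 1%N) a b :
  dd (fun a b => op_comp i (u b) (v a)) a b =
  op_comp i (u b - u b.+1) (v a - v a.+1).
Proof. by rewrite compBl !compBr. Qed.

(* Meant for s and t being l and r in either order, with d and e the primed
   generators of s and t. *)
Lemma comp_maxC i j :
  (forall a b, op_comp i (s a) (s b) = op_comp j (s (omax a b)) (s a)) <->
  [/\ forall a b : 'I_g, (a < b)%N ->
        op_comp i (d a) (d b) = op_comp j (d b) (d a),
      forall a b : 'I_g, (a < b)%N -> op_comp i (d b) (d a) = 0
    & forall a : 'I_g, op_comp i (d a) (d a) =
        \sum_(b < g | (a <= b)%N) op_comp j (d a) (d b)].
Proof.
pose X a b := op_comp i (ext0 s a) (ext0 s b).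
pose Y a b := op_comp j (ext0 s b) (ext0 s a).
have ddX (a b : 'I_g) : dd X a b = op_comp i (d a) (d b).
  by rewrite dd_comp !dE.
have ddY (a b : 'I_g) : dd Y a b = op_comp j (d b) (d a).
  by rewrite dd_compC !dE.
(* A single difference puts [d a] in one slot and leaves [s a] in the other; expanding [s a] as the
   sum of the [d b] with [a <= b] produces the sums in the relations. *)
have Yd (a : 'I_g) : Y a a - Y a a.+1 =
    \sum_(b < g | (a <= b)%N) op_comp j (d a) (d b).
  by rewrite -comp_sumr sum_differences /Y -compBl dE ext0_ord.
have X0 a b : (g <= a)%N || (g <= b)%N -> X a b = 0 by exact: ext0_comp_out.
have Y0 a b : (g <= a)%N || (g <= b)%N -> Y a b = 0.
  by rewrite orbC; exact: ext0_comp_out.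
split=> [XY|[dlt dgt deq]].
  have /(max_ddP X0 Y0)[dlt dgt deq] : forall a b : 'I_g, X a b = Y a (omax a b).
    by move=> a b; rewrite /X /Y !ext0_ord.
  by split=> *; rewrite -?ddX -?ddY -?Yd; auto.
have XY : forall a b : 'I_g, X a b = Y a (omax a b).
  by apply/(max_ddP X0 Y0); split=> *; rewrite ddX ?ddY ?Yd; auto.
by move=> a b; have := XY a b; rewrite /X /Y !ext0_ord.
Qed.

(** Here two families meet on the left-hand side, and [Y] keeps its arguments in order, so the sum
    on the diagonal runs over the first slot. *)
Lemma comp_max i j :
  (forall a b, op_comp i (s a) (t b) = op_comp j (s a) (s (omax a b))) <->
  [/\ forall a b : 'I_g, (a < b)%N ->
        op_comp i (d a) (e b) = op_comp j (d a) (d b),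
      forall a b : 'I_g, (a < b)%N -> op_comp i (d b) (e a) = 0
    & forall a : 'I_g, op_comp i (d a) (e a) =
        \sum_(b < g | (a <= b)%N) op_comp j (d b) (d a)].
Proof.
pose X a b := op_comp i (ext0 s a) (ext0 t b).
pose Y a b := op_comp j (ext0 s a) (ext0 s b).
have ddX (a b : 'I_g) : dd X a b = op_comp i (d a) (e b).
  by rewrite dd_comp dE eE.
have ddY (a b : 'I_g) : dd Y a b = op_comp j (d a) (d b).
  by rewrite dd_comp !dE.
have Yd (a : 'I_g) : Y a a - Y a a.+1 =
    \sum_(b < g | (a <= b)%N) op_comp j (d b) (d a).
  by rewrite -comp_suml sum_differences /Y -compBr dE ext0_ord.
have X0 a b : (g <= a)%N || (g <= b)%N -> X a b = 0 by exact: ext0_comp_out.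
have Y0 a b : (g <= a)%N || (g <= b)%N -> Y a b = 0 by exact: ext0_comp_out.
split=> [XY|[dlt dgt deq]].
  have /(max_ddP X0 Y0)[dlt dgt deq] : forall a b : 'I_g, X a b = Y a (omax a b).
    by move=> a b; rewrite /X /Y !ext0_ord.
  by split=> *; rewrite -?ddX -?ddY -?Yd; auto.
have XY : forall a b : 'I_g, X a b = Y a (omax a b).
  by apply/(max_ddP X0 Y0); split=> *; rewrite ddX ?ddY ?Yd; auto.
by move=> a b; have := XY a b; rewrite /X /Y !ext0_ord.
Qed.

End Families.

Variables l r p q : 'I_g -> P 1%N.

Record pluriassociative : Prop := Pluriassociative {
  pluri_l1r : forall a b, l a \o1 r b = r b \o2 l a;
  pluri_r1r : forall a b, r a \o1 r b = r (omax a b) \o2 r a;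
  pluri_r1l : forall a b, r a \o1 l b = r a \o2 r (omax a b);
  pluri_l2l : forall a b, l a \o2 l b = l (omax a b) \o1 l a;
  pluri_l2r : forall a b, l a \o2 r b = l a \o1 l (omax a b)
}.

Record primed_relations : Prop := PrimedRelations {
  primed_lr : forall a b, p a \o1 q b = q b \o2 p a;
  primed_r1r0 : forall a b : 'I_g, (a < b)%N -> q b \o1 q a = 0;
  primed_l2l0 : forall a b : 'I_g, (a < b)%N -> p b \o2 p a = 0;
  primed_r1l0 : forall a b : 'I_g, (a < b)%N -> q b \o1 p a = 0;
  primed_l2r0 : forall a b : 'I_g, (a < b)%N -> p b \o2 q a = 0;
  primed_rr : forall a b : 'I_g, (a < b)%N -> q a \o1 q b = q b \o2 q a;
  primed_ll : forall a b : 'I_g, (a < b)%N -> p b \o1 p a = p a \o2 p b;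
  primed_r1l : forall a b : 'I_g, (a < b)%N -> q a \o1 p b = q a \o2 q b;
  primed_l2r : forall a b : 'I_g, (a < b)%N -> p a \o1 p b = p a \o2 q b;
  primed_sum_r : forall a : 'I_g,
    q a \o1 q a = \sum_(b < g | (a <= b)%N) q a \o2 q b;
  primed_sum_l : forall a : 'I_g,
    \sum_(b < g | (a <= b)%N) p a \o1 p b = p a \o2 p a;
  primed_sum_rl : forall a : 'I_g,
    q a \o1 p a = \sum_(b < g | (a <= b)%N) q b \o2 q a;
  primed_sum_lr : forall a : 'I_g,
    \sum_(b < g | (a <= b)%N) p b \o1 p a = p a \o2 q a
}.

Hypothesis pE : forall a : 'I_g, p a = ext0 l a - ext0 l a.+1.
Hypothesis qE : forall a : 'I_g, q a = ext0 r a - ext0 r a.+1.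

(** Four of the five relations are instances of [comp_max] or [comp_maxC], the left and right
    versions being exchanged together with the two inputs. The remaining one involves no maximum and
    passes through differences and sums by bilinearity. *)
Lemma pluriassociativeP : pluriassociative <-> primed_relations.
Proof.
split=> [[lr /(comp_maxC qE)[] ? ? ? /(comp_max qE pE)[] ? ? ?
  /(comp_maxC pE)[] ? ? ? /(comp_max pE qE)[] ? ? ?]|].
  have LR (a b : nat) : ext0 l a \o1 ext0 r b = ext0 r b \o2 ext0 l a.
    rewrite /ext0; case: insubP => [? _ _|_]; last by rewrite comp0l comp0r.
    by case: insubP => [? _ _|_]; rewrite ?lr // comp0l comp0r.
  split=> //; try by move=> *; apply: esym; auto.
  (* Both sides expand into the same four terms, with the two middle ones exchanged. *)
  by move=> a b; rewrite pE qE !compBl !compBr !LR !opprB addrACA [RHS]addrACA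
    [_ + - _]addrC.
case=> lr r1r0 l2l0 r1l0 l2r0 rr ll r1l l2r sr sl srl slr; split.
- move=> a b; rewrite -(sum_differences pE) -(sum_differences qE).
  rewrite comp_suml comp_sumr; apply: eq_bigr => c _.
  by rewrite comp_sumr comp_suml; apply: eq_bigr.
- by apply/(comp_maxC qE).
- by apply/(comp_max qE pE).
- by apply/(comp_maxC pE); split=> // *; apply: esym; auto.
- by apply/(comp_max pE qE); split=> // *; apply: esym; auto.
Qed.

End Pluriassociativity.

(** * Vanishing of the relators under an operad morphism *)

Section RelatorImages.
Variables (K : fieldType) (O P : operad K) (h : operad_hom O P).
Variables (i j : 'I_2) (x y x' y' : O 1%N) (I : finType) (Q : pred I).
Variables f f' : I -> O 1%N.

Lemma hom_compB_eq0 : h 2 (op_comp i x y - op_comp j x' y') = 0 <->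
  op_comp i (h 1%N x) (h 1%N y) = op_comp j (h 1%N x') (h 1%N y').
Proof.
have -> : h 2 (op_comp i x y - op_comp j x' y') =
  op_comp i (h 1%N x) (h 1%N y) - op_comp j (h 1%N x') (h 1%N y').
  by rewrite homB !hom_comp11.
by split=> [/eqP|->]; rewrite ?subrr // subr_eq0 => /eqP.
Qed.

Lemma hom_compB_sum_eq0 :
  h 2 (op_comp i x y - \sum_(k | Q k) op_comp j (f k) (f' k)) = 0 <->
  op_comp i (h 1%N x) (h 1%N y) =
  \sum_(k | Q k) op_comp j (h 1%N (f k)) (h 1%N (f' k)).
Proof.
have -> : h 2 (op_comp i x y - \sum_(k | Q k) op_comp j (f k) (f' k)) =
  op_comp i (h 1%N x) (h 1%N y) -
  \sum_(k | Q k) op_comp j (h 1%N (f k)) (h 1%N (f' k)).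
  by rewrite homB hom_sum hom_comp11; under eq_bigr do rewrite hom_comp11.
by split=> [/eqP|->]; rewrite ?subrr // subr_eq0 => /eqP.
Qed.

Lemma hom_sumB_comp_eq0 :
  h 2 (\sum_(k | Q k) op_comp i (f k) (f' k) - op_comp j x y) = 0 <->
  \sum_(k | Q k) op_comp i (h 1%N (f k)) (h 1%N (f' k)) =
  op_comp j (h 1%N x) (h 1%N y).
Proof.
have -> : h 2 (\sum_(k | Q k) op_comp i (f k) (f' k) - op_comp j x y) =
  \sum_(k | Q k) op_comp i (h 1%N (f k)) (h 1%N (f' k)) -
  op_comp j (h 1%N x) (h 1%N y).
  by rewrite homB hom_sum hom_comp11; under eq_bigr do rewrite hom_comp11.
by split=> [/eqP|->]; rewrite ?subrr // subr_eq0 => /eqP.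
Qed.

End RelatorImages.

Section Relators.
Variables (K : fieldType) (g : nat) (P : operad K).
Variable h : operad_hom (free_operad K (dias_symbol g)) P.

(** The case distinction in [lp] is absorbed by the zero extension, as [insub a.+1] fails exactly at
    the last index. *)
Lemma hom_lp (a : 'I_g) : h 1%N (lp K a) =
  ext0 (fun b => h 1%N (left_gen K b)) a -
  ext0 (fun b => h 1%N (left_gen K b)) a.+1.
Proof.
rewrite ext0_ord /ext0 /lp; case: (insub a.+1) => [b|].
  exact: homB.
by rewrite subr0.
Qed.

Lemma hom_rp (a : 'I_g) : h 1%N (rp K a) =
  ext0 (fun b => h 1%N (right_gen K b)) a -
  ext0 (fun b => h 1%N (right_gen K b)) a.+1.
Proof.
rewrite ext0_ord /ext0 /rp; case: (insub a.+1) => [b|].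
  exact: homB.
by rewrite subr0.
Qed.

(** It serves in both directions: for evaluation into [dias] it shows that the relators are killed,
    for the quotient map that the unprimed relations hold in the quotient. *)
Lemma relatorsP :
  (forall x, @primed_relator K g x -> h 2 x = 0) <->
  pluriassociative (fun a => h 1%N (left_gen K a))
                   (fun a => h 1%N (right_gen K a)).
Proof.
apply: iff_trans (iff_sym (pluriassociativeP hom_lp hom_rp)); split=> [rel|].
  split=> [a b|a b ab|a b ab|a b ab|a b ab|a b ab|a b ab|a b ab|a b ab|a|a|a|a].
  - exact/hom_compB_eq0/rel/rel_lr.
  - by rewrite -hom_comp11; exact/rel/rel_r1r0.
  - by rewrite -hom_comp11; exact/rel/rel_l2l0.
  - by rewrite -hom_comp11; exact/rel/rel_r1l0.
  - by rewrite -hom_comp11; exact/rel/rel_l2r0.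
  - exact/hom_compB_eq0/rel/rel_rr.
  - exact/hom_compB_eq0/rel/rel_ll.
  - exact/hom_compB_eq0/rel/rel_r1l.
  - exact/hom_compB_eq0/rel/rel_l2r.
  - exact/hom_compB_sum_eq0/rel/rel_sum_r.
  - exact/hom_sumB_comp_eq0/rel/rel_sum_l.
  - exact/hom_compB_sum_eq0/rel/rel_sum_rl.
  - exact/hom_sumB_comp_eq0/rel/rel_sum_lr.
case=> lr r1r0 l2l0 r1l0 l2r0 rr ll r1l l2r sr sl srl slr x.
case=> [a b|a b ab|a b ab|a b ab|a b ab|a b ab|a b ab|a b ab|a b ab|a|a|a|a].
- exact/hom_compB_eq0/lr.
- by rewrite hom_comp11; exact: r1r0.
- by rewrite hom_comp11; exact: l2l0.
- by rewrite hom_comp11; exact: r1l0.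
- by rewrite hom_comp11; exact: l2r0.
- exact/hom_compB_eq0/rr.
- exact/hom_compB_eq0/ll.
- exact/hom_compB_eq0/r1l.
- exact/hom_compB_eq0/l2r.
- exact/hom_compB_sum_eq0/sr.
- exact/hom_sumB_comp_eq0/sl.
- exact/hom_compB_sum_eq0/srl.
- exact/hom_sumB_comp_eq0/slr.
Qed.

End Relators.

Lemma eq_pluriassociative (K : fieldType) (g : nat) (P : operad K)
    (l r l' r' : 'I_g -> P 1%N) :
  l =1 l' -> r =1 r' -> pluriassociative l r -> pluriassociative l' r'.
Proof. by move=> /funext -> /funext ->. Qed.

(** * Composition of words and evaluation of trees as words *)

Section WordComp.
Variable g : nat.
Implicit Types (u v w : seq 'I_g.+1) (i : nat).

Lemma word_comp_catl u w i v : (i < size u)%N ->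
  word_comp (u ++ w) i v = word_comp u i v ++ w.
Proof.
move=> iu; have [u1 [a [u2 [-> su1]]]] := seq_split iu.
by rewrite -catA !(word_comp_cat _ _ _ su1) -!catA.
Qed.

Lemma word_comp_catr u w i v : (i < size w)%N ->
  word_comp (u ++ w) (size u + i) v = u ++ word_comp w i v.
Proof.
move=> iw; have [w1 [a [w2 [-> sw1]]]] := seq_split iw.
by rewrite catA !word_comp_cat ?size_cat ?sw1 // -catA.
Qed.

Lemma word_comp_map a u i v : (i < size u)%N ->
  word_comp (map (lmax a) u) i v = map (lmax a) (word_comp u i v).
Proof.
move=> iu; have [u1 [b [u2 [-> su1]]]] := seq_split iu.
rewrite map_cat (word_comp_cat _ _ _ su1) /= word_comp_cat ?size_map //.
rewrite !map_cat -map_comp; congr (_ ++ (_ ++ _)).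
by apply: eq_map => c /=; rewrite lmaxA.
Qed.

Lemma lmax0r (a : 'I_g.+1) : lmax a ord0 = a.
Proof. by apply: val_inj; rewrite /lmax; case: ifP => //=; lia. Qed.

Lemma lmax_lift (a b : 'I_g) :
  lmax (lift ord0 a) (lift ord0 b) = lift ord0 (omax a b).
Proof. by rewrite /lmax /omax /= ltnS; case: ifP. Qed.

End WordComp.

Lemma dias_pluriassociative (K : fieldType) (g : nat) :
  pluriassociative (P := dias K g)
    (fun a => dias_gen K (inl a : dias_symbol g))
    (fun a => dias_gen K (inr a : dias_symbol g)).
Proof.
split=> a b; rewrite /dias_gen /= !lin_compE; congr (lin_base _ _);
  apply: val_inj; rewrite /= /word_comp ?inordK //= ?lmax_lift ?lmax0r //.
Qed.

Section Evaluation.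
Variable g : nat.
Implicit Types s t : tree (dias_symbol g).

(** The letter at a leaf is the largest label among the ancestors [inl a] having the leaf on their
    right and [inr a] having it on their left, or 0 if there are none. *)
Fixpoint tree_eval t : seq 'I_g.+1 :=
  match t with
  | Leaf => [:: ord0]
  | Node (inl a) l r => tree_eval l ++ map (lmax (lift ord0 a)) (tree_eval r)
  | Node (inr a) l r => map (lmax (lift ord0 a)) (tree_eval l) ++ tree_eval r
  end.

Lemma size_tree_eval t : size (tree_eval t) = leaves t.
Proof.
by elim: t => //= -[] a l IHl r IHr; rewrite size_cat size_map IHl IHr.
Qed.

Lemma count_tree_eval t : count_mem ord0 (tree_eval t) = 1%N.
Proof.
have max0 (a : 'I_g) w : count_mem ord0 (map (lmax (lift ord0 a)) w) = 0%N.
  rewrite count_map (@eq_count _ _ pred0) ?count_pred0 // => b /=.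
  by rewrite lmax_eq0.
by elim: t => //= -[] a l IHl r IHr; rewrite count_cat max0 ?IHl ?IHr.
Qed.

(** Position [i] falls in the block of one subtree, and joining a block with a letter commutes with
    inserting a word into it because the maximum is associative. *)
Lemma tree_eval_graft s i t : (i < leaves s)%N ->
  tree_eval (graft s i t) = word_comp (tree_eval s) i (tree_eval t).
Proof.
elim: s i => [|a l IHl r IHr] i /=.
  by case: i => // _; rewrite /word_comp /= cats0 (eq_map (@lmax0l _)) map_id.
case: ifP => il ir; have sl := size_tree_eval l; have sr := size_tree_eval r.
  case: a => a /=; rewrite IHl //; first by rewrite word_comp_catl ?sl.
  by rewrite word_comp_catl ?size_map ?sl // word_comp_map ?sl.
have ir' : (i - leaves l < leaves r)%N by lia.
have ei : i = (leaves l + (i - leaves l))%N by lia.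
move: (i - leaves l)%N ir' ei => k kr ->.
case: a => a /=; rewrite IHr // -sl.
  by rewrite word_comp_catr ?size_map ?word_comp_map ?sr.
by rewrite -(size_map (lmax (lift ord0 a))) word_comp_catr ?sr.
Qed.

Lemma ntree_eval_subproof n (t : ntree (dias_symbol g) n) :
  (size (tree_eval t) == n.+1) && (count_mem ord0 (tree_eval t) == 1%N).
Proof. by rewrite size_tree_eval count_tree_eval ntree_leaves !eqxx. Qed.

Definition ntree_eval n (t : tree_operad (dias_symbol g) n) :
  word_operad g n := Word (ntree_eval_subproof t).

Lemma ntree_eval_unit : ntree_eval (set_unit (tree_operad _)) =
  set_unit (word_operad g).
Proof. exact: val_inj. Qed.

Lemma ntree_eval_comp n m (i : 'I_n.+1) (s : tree_operad (dias_symbol g) n)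
    (t : tree_operad (dias_symbol g) m) :
  ntree_eval (set_comp i s t) = set_comp i (ntree_eval s) (ntree_eval t).
Proof. by apply: val_inj; rewrite /= tree_eval_graft ?ntree_leaves. Qed.

Variable K : fieldType.

Definition eval_hom : operad_hom (free_operad K (dias_symbol g)) (dias K g) :=
  linearize K ntree_eval_unit ntree_eval_comp.

Lemma eval_hom_gen (s : dias_symbol g) :
  eval_hom 1%N (free_gen K s) = dias_gen K s.
Proof.
rewrite [LHS]linearize_base /dias_gen; congr (lin_base _ _).
by apply: val_inj; case: s => a /=; rewrite lmax0r.
Qed.

Lemma eval_hom_relator x : @primed_relator K g x -> eval_hom 2 x = 0.
Proof.
apply/relatorsP: x.
apply: eq_pluriassociative (@dias_pluriassociative K g) => a;
  apply: esym; exact: eval_hom_gen.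
Qed.

End Evaluation.

(** * Congruence of trees modulo an ideal *)

Section TreeCongruence.
Variables (K : fieldType) (S : finType) (J : ideal (free_operad K S)).
Implicit Types s t x y z : tree S.

Definition pi_tree n (t : ntree S n) : quot J n :=
  quot_pi J (lin_base K (t : tree_operad S n) : free_operad K S n).

Lemma pi_tree_graft n m (i : 'I_n.+1) (s : ntree S n) (t : ntree S m) :
  pi_tree (ngraft i s t) = quot_comp i (pi_tree s) (pi_tree t).
Proof.
rewrite /pi_tree quot_compE; congr (quot_pi J _); apply: esym.
exact: (@lin_compE K (tree_operad S)).
Qed.

(* Stated on trees of unspecified arity, which avoids arity casts. *)
Definition tree_cong s t : Prop :=
  exists n (u v : ntree S n),
    [/\ u = s :> tree S, v = t :> tree S & pi_tree u = pi_tree v].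

Lemma tree_cong_refl t : tree_cong t t.
Proof.
have lt : leaves t == (leaves t).-1.+1 by rewrite prednK ?leaves_gt0.
by exists (leaves t).-1, (NTree lt), (NTree lt).
Qed.

Lemma tree_cong_trans y x z :
  tree_cong x y -> tree_cong y z -> tree_cong x z.
Proof.
move=> [n [u [v [<- <- uv]]]] [m [u' [v' [e <- uv']]]].
have nm : m = n.
  by apply/eqP; rewrite -eqSS -(ntree_leaves u') -(ntree_leaves v) e.
subst m; exists n, u, v'; split=> //.
by rewrite uv -uv'; congr pi_tree; apply: val_inj.
Qed.

Lemma tree_cong_graft s s' i t t' : (i < leaves s)%N ->
  tree_cong s s' -> tree_cong t t' -> tree_cong (graft s i t) (graft s' i t').
Proof.
move=> + [n [u [v [us <- uv]]]] [m [x [y [<- <- xy]]]].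
rewrite -us ntree_leaves => iu; pose k := Ordinal iu.
exists (n + m)%N, (ngraft k u x), (ngraft k v y); split=> //.
by rewrite !pi_tree_graft uv xy.
Qed.

Lemma tree_cong_node a x x' y y' :
  tree_cong x x' -> tree_cong y y' -> tree_cong (Node a x y) (Node a x' y').
Proof.
(* [Node a x y] is the corolla of [a] with [y] grafted at leaf 1, then [x] at leaf 0; in this order
   the index of the second graft does not shift. *)
move=> xx /(tree_cong_graft (s := Node a Leaf Leaf) (i := 1) isT).
move=> /(_ _ (tree_cong_refl _))/(tree_cong_graft (i := 0)).
by move=> /(_ _ _ isT)/(_ xx).
Qed.

(** The number of leaves determines the arity, so the witnesses of the congruence are [s] and [t]
    themselves. *)
Lemma tree_cong_ntree n (s t : ntree S n) :
  tree_cong s t -> pi_tree s = pi_tree t.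
Proof.
move=> [m [u [v [us vt uv]]]].
have nm : m = n.
  by apply/eqP; rewrite -eqSS -(ntree_leaves u) -(ntree_leaves s) us.
subst m; have <- : u = s by exact: val_inj.
by have <- : v = t by exact: val_inj.
Qed.

Lemma tree_cong_fill s s' x y z : leaves s = 3 -> tree_cong s s' ->
  tree_cong (graft (graft (graft s 2 z) 1 y) 0 x)
            (graft (graft (graft s' 2 z) 1 y) 0 x).
Proof.
move=> l3 ss; have lx := leaves_gt0 x.
have ly := leaves_gt0 y; have lz := leaves_gt0 z.
have H2 := tree_cong_graft (i := 2) _ ss (tree_cong_refl z).
have H1 := tree_cong_graft (i := 1) _ (H2 _) (tree_cong_refl y).
apply: (tree_cong_graft (i := 0) _ (H1 _ _) (tree_cong_refl x));
  by rewrite ?leaves_graft ?l3 //; lia.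
Qed.

Notation pi_gen a := (quot_pi J (free_gen K a)).

(* The partial composition of two corollas has three leaves; x, y and z are
   grafted onto them from right to left so that the indices do not shift. *)
Lemma tree_cong_comp (i j : 'I_2) a b c d x y z :
  quot_comp i (pi_gen a) (pi_gen b) = quot_comp j (pi_gen c) (pi_gen d) ->
  tree_cong
    (graft (graft (graft (graft (corolla a) i (corolla b)) 2 z) 1 y) 0 x)
    (graft (graft (graft (graft (corolla c) j (corolla d)) 2 z) 1 y) 0 x).
Proof.
move=> abcd; apply: tree_cong_fill; first by rewrite leaves_graft //=.
exists 2, (ngraft i (corolla a) (corolla b)), (ngraft j (corolla c) (corolla d)).
by split=> //; rewrite !pi_tree_graft.
Qed.

End TreeCongruence.

(** * Rewriting trees to normal form *)

Section NormalForms.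
Variables (K : fieldType) (g : nat).
Variable J : ideal (free_operad K (dias_symbol g)).
Hypothesis pluriJ : pluriassociative (P := quot_operad J)
  (fun a => quot_pi J (left_gen K a)) (fun a => quot_pi J (right_gen K a)).

Local Notation tr := (tree (dias_symbol g)).
Local Notation "x ~~ y" := (tree_cong J x y) (at level 70).
Local Notation nl a := (Node (inl a : dias_symbol g)).
Local Notation nr a := (Node (inr a : dias_symbol g)).
Implicit Types (x y z : tr) (a b : 'I_g) (u v : seq 'I_g).

(** [inord 1] does not compute, whereas the literal [1] lets [graft] reduce to the explicit trees
    below. *)
Let o2 : inord 1 = 1 :> 'I_2. Proof. by apply: val_inj; rewrite /= inordK. Qed.

Lemma cong_lr a b x y z : nl a (nr b x y) z ~~ nr b x (nl a y z).
Proof.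
have := pluri_l1r pluriJ a b; rewrite /= o2 => e.
exact: (tree_cong_comp x y z e).
Qed.

Lemma cong_rr a b x y z : nr a (nr b x y) z ~~ nr (omax a b) x (nr a y z).
Proof.
have := pluri_r1r pluriJ a b; rewrite /= o2 => e.
exact: (tree_cong_comp x y z e).
Qed.

Lemma cong_rl a b x y z : nr a (nl b x y) z ~~ nr a x (nr (omax a b) y z).
Proof.
have := pluri_r1l pluriJ a b; rewrite /= o2 => e.
exact: (tree_cong_comp x y z e).
Qed.

Lemma cong_ll a b x y z : nl a x (nl b y z) ~~ nl (omax a b) (nl a x y) z.
Proof.
have := pluri_l2l pluriJ a b; rewrite /= o2 => e.
exact: (tree_cong_comp x y z e).
Qed.

Lemma cong_lr2 a b x y z : nl a x (nr b y z) ~~ nl a (nl (omax a b) x y) z.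
Proof.
have := pluri_l2r pluriJ a b; rewrite /= o2 => e.
exact: (tree_cong_comp x y z e).
Qed.

(** On words, [prefix] and [suffix] write the letters of a sequence before and after the word of
    [x]. *)
Definition prefix u x : tr := foldr (fun a t => nr a Leaf t) x u.
Definition suffix x v : tr := foldl (fun t b => nl b t Leaf) x v.

Lemma prefix_cat u v x : prefix (u ++ v) x = prefix u (prefix v x).
Proof. exact: foldr_cat. Qed.

Lemma suffix_cat x u v : suffix x (u ++ v) = suffix (suffix x u) v.
Proof. exact: foldl_cat. Qed.

(* The normal form with word u 0 v. *)
Definition normal_form (uv : seq 'I_g * seq 'I_g) : tr :=
  prefix uv.1 (suffix Leaf uv.2).

(** This is [tree_eval] kept as the two factors around the letter 0; the 0 of the subtree joined
    with [a] becomes the letter [a]. *)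
Fixpoint normal_pair x : seq 'I_g * seq 'I_g :=
  match x with
  | Leaf => ([::], [::])
  | Node (inl a) l r =>
      let: (u, v) := normal_pair l in let: (u', v') := normal_pair r in
      (u, v ++ map (omax a) u' ++ a :: map (omax a) v')
  | Node (inr a) l r =>
      let: (u, v) := normal_pair l in let: (u', v') := normal_pair r in
      (map (omax a) u ++ a :: map (omax a) v ++ u', v')
  end.

Lemma cong_prefix u x y : x ~~ y -> prefix u x ~~ prefix u y.
Proof.
move=> xy; elim: u => //= a u; apply: tree_cong_node.
exact: tree_cong_refl.
Qed.

Lemma cong_suffix v x y : x ~~ y -> suffix x v ~~ suffix y v.
Proof.
elim: v x y => //= b v IH x y xy; apply/IH/tree_cong_node => //.
exact: tree_cong_refl.
Qed.

Lemma cong_nr_prefix a u x y :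
  nr a (prefix u x) y ~~ prefix (map (omax a) u) (nr a x y).
Proof.
elim: u => [|b u IH] /=; first exact: tree_cong_refl.
apply: tree_cong_trans (cong_rr _ _ _ _ _) _.
exact: tree_cong_node (tree_cong_refl _ _) IH.
Qed.

Lemma cong_nr_suffix a v y :
  nr a (suffix Leaf v) y ~~ prefix (a :: map (omax a) v) y.
Proof.
(* The root of a left comb carries its last letter, which is where [cong_rl] applies. The letter
   moves onto [y], so [y] must vary in the induction. *)
elim/last_ind: v y => [|v b IH] y; first exact: tree_cong_refl.
rewrite /suffix foldl_rcons -/(suffix _ _) map_rcons -rcons_cons.
rewrite /prefix foldr_rcons -/(prefix _ _).
exact: tree_cong_trans (cong_rl _ _ _ _ _) (IH _).
Qed.

Lemma cong_nl_prefix_l a u x y :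
  nl a (prefix u x) y ~~ prefix u (nl a x y).
Proof.
elim: u => [|b u IH] /=; first exact: tree_cong_refl.
apply: tree_cong_trans (cong_lr _ _ _ _ _) _.
exact: tree_cong_node (tree_cong_refl _ _) IH.
Qed.

Lemma cong_suffix_prefix u x v :
  suffix (prefix u x) v ~~ prefix u (suffix x v).
Proof.
elim: v x => [|b v IH] x /=; first exact: tree_cong_refl.
apply: tree_cong_trans (IH _); apply: cong_suffix.
exact: cong_nl_prefix_l.
Qed.

Lemma cong_nl_prefix_r a x u y :
  nl a x (prefix u y) ~~ nl a (suffix x (map (omax a) u)) y.
Proof.
elim: u x => [|b u IH] x /=; first exact: tree_cong_refl.
exact: tree_cong_trans (cong_lr2 _ _ _ _ _) (IH _).
Qed.

Lemma cong_nl_suffix a x v :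
  nl a x (suffix Leaf v) ~~ suffix x (a :: map (omax a) v).
Proof.
elim/last_ind: v => [|v b IH]; first exact: tree_cong_refl.
rewrite /suffix foldl_rcons -/(suffix _ _) map_rcons -rcons_cons.
rewrite foldl_rcons -/(suffix _ _).
apply: tree_cong_trans (cong_ll _ _ _ _ _) _.
exact: tree_cong_node IH (tree_cong_refl _ _).
Qed.

Lemma cong_normal_form x : x ~~ normal_form (normal_pair x).
Proof.
elim: x => [|[a|a] l IHl r IHr] /=; first exact: tree_cong_refl.
  have := tree_cong_node (inl a : dias_symbol g) IHl IHr.
  move/tree_cong_trans; apply.
  case: (normal_pair l) (normal_pair r) => [u v] [u' v'].
  rewrite /normal_form /=.
  (* The right operand is absorbed as a suffix of the left one, first its [u'], then [a] and [v'];
     the prefix [u] is then moved out of the suffixes. *)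
  apply: tree_cong_trans (cong_nl_prefix_r _ _ _ _) _.
  apply: tree_cong_trans (cong_nl_suffix _ _ _) _.
  rewrite -suffix_cat [suffix Leaf (v ++ _)]suffix_cat.
  exact: cong_suffix_prefix.
have := tree_cong_node (inr a : dias_symbol g) IHl IHr.
move/tree_cong_trans; apply.
case: (normal_pair l) (normal_pair r) => [u v] [u' v'].
rewrite /normal_form /=.
(* The left operand dissolves into prefixes of the right one: [u] is pulled out, then [a] and [v]
   follow. *)
apply: tree_cong_trans (cong_nr_prefix _ _ _ _) _.
rewrite prefix_cat; apply: cong_prefix.
apply: tree_cong_trans (cong_nr_suffix _ _ _) _.
rewrite -cat_cons prefix_cat; exact: tree_cong_refl.
Qed.

End NormalForms.

(** * Bijection between normal forms and words *)

Section SplitWords.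
Variable g : nat.
Implicit Types (w : seq 'I_g.+1) (u v : seq 'I_g).

Definition pair_word (uv : seq 'I_g * seq 'I_g) : seq 'I_g.+1 :=
  map (lift ord0) uv.1 ++ ord0 :: map (lift ord0) uv.2.

Definition split_word w : seq 'I_g * seq 'I_g :=
  (pmap (unlift ord0) (take (index ord0 w) w),
   pmap (unlift ord0) (drop (index ord0 w).+1 w)).

Lemma pmap_unlift u : pmap (unlift ord0) (map (lift ord0) u) = u.
Proof. by elim: u => //= a u ->; rewrite liftK. Qed.

Lemma pair_wordK : cancel pair_word split_word.
Proof.
case=> u v; rewrite /split_word /pair_word /=.
have -> : index ord0 (map (lift ord0) u ++ ord0 :: map (lift ord0) v) = size u.
  by elim: u => //= a u ->.
rewrite take_size_cat ?size_map // -cat_rcons drop_size_cat.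
  by rewrite !pmap_unlift.
by rewrite size_rcons size_map.
Qed.

Lemma map_lift_unlift w : ord0 \notin w ->
  map (lift ord0) (pmap (unlift ord0) w) = w.
Proof.
elim: w => //= a w IH; rewrite inE negb_or => /andP[a0 /IH w0].
by case: unliftP a0 => [b ->|->] //=; rewrite w0.
Qed.

Lemma split_wordK w : count_mem ord0 w = 1%N -> pair_word (split_word w) = w.
Proof.
move=> w1; have w0 : ord0 \in w by rewrite -has_pred1 has_count w1.
case/splitPr: w0 w1 => u v; rewrite count_cat /= => uv.
have /andP[u0 v0] : (ord0 \notin u) && (ord0 \notin v).
  rewrite -!has_pred1 !has_count -!leqNgt !leqn0 -addn_eq0.
  by apply/eqP; case: uv; rewrite addnCA => -[].
by rewrite -(map_lift_unlift u0) -(map_lift_unlift v0) (pair_wordK (_, _)).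
Qed.

Lemma tree_eval_suffix x v :
  tree_eval (suffix x v) = tree_eval x ++ map (lift ord0) v.
Proof.
by elim: v x => [|a v IH] x /=; rewrite ?cats0 // IH /= lmax0r -catA.
Qed.

Lemma tree_eval_normal_form uv : tree_eval (normal_form uv) = pair_word uv.
Proof.
case: uv => u v; rewrite /normal_form /pair_word /=.
by elim: u => [|a u IH] /=; rewrite ?tree_eval_suffix // IH lmax0r.
Qed.

(** Since [pair_word] is injective, the normal form of a tree depends only on its word, whence
    evaluation is injective modulo the relations. *)
Lemma pair_word_normal_pair t : pair_word (normal_pair t) = tree_eval t.
Proof.
have mapl (a : 'I_g) u : map (lift ord0) (map (omax a) u) =
    map (lmax (lift ord0 a)) (map (lift ord0) u).
  by rewrite -!map_comp; apply: eq_map => b /=; rewrite lmax_lift.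
elim: t => //= -[a|a] l <- r <-;
  case: (normal_pair l) (normal_pair r) => [u v] [u' v'];
  by rewrite /pair_word /= ?(map_cat, map_cons, cat_cons, mapl, lmax0r, =^~ catA).
Qed.

Lemma normal_tree_subproof n (w : word g n) :
  leaves (normal_form (split_word w)) == n.+1.
Proof.
by rewrite -size_tree_eval tree_eval_normal_form split_wordK ?word_count //
  word_size.
Qed.

Definition normal_tree n (w : word_operad g n) :
  tree_operad (dias_symbol g) n := NTree (normal_tree_subproof w).

Lemma normal_treeK n : cancel (@normal_tree n) (@ntree_eval g n).
Proof.
move=> w; apply: val_inj; rewrite /= tree_eval_normal_form.
by rewrite split_wordK ?word_count.
Qed.

End SplitWords.

(** * The isomorphism between the quotient and [dias] *)

Section Presentation.
Variables (K : fieldType) (g : nat).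

Local Notation F := (free_operad K (dias_symbol g)).
Local Notation J := (gen_ideal (span_of (@primed_relator K g))).

Lemma quot_pluriassociative : pluriassociative (P := quot_operad J)
  (fun a => quot_pi J (left_gen K a)) (fun a => quot_pi J (right_gen K a)).
Proof. by apply/(relatorsP (quot_hom J)) => x; exact: relator_gen_ideal. Qed.

Lemma pi_normal_tree n (t : tree_operad (dias_symbol g) n) :
  pi_tree J (normal_tree (ntree_eval t)) = pi_tree J t.
Proof.
apply/esym/tree_cong_ntree; rewrite /= -pair_word_normal_pair pair_wordK.
exact: cong_normal_form quot_pluriassociative _.
Qed.

Definition presentation_hom : operad_hom (quot_operad J) (dias K g) :=
  quot_lift (gen_ideal_ker (@eval_hom_relator g K)).

Lemma presentation_hom_pi n (x : F n) :
  presentation_hom n (quot_pi J x) = eval_hom g K n x.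
Proof. exact: (quot_lift_pi (gen_ideal_ker (@eval_hom_relator g K))). Qed.

(** A word is sent to the class of its normal form; both cancellations are then checked on bases
    through [lin_ext]. *)
Definition presentation_inv n : dias K g n -> quot_operad J n :=
  lin_lift (fun w : word_operad g n => pi_tree J (normal_tree w)).

Lemma presentation_invK n : cancel (@presentation_inv n) (presentation_hom n).
Proof.
apply: (@lin_ext K (word_operad g) n _
  (fun x => presentation_hom n (presentation_inv x)) idfun) => [a x y|//|w].
  by rewrite /presentation_inv lin_lift_linear (@hom_linear _ _ _ presentation_hom).
rewrite /presentation_inv lin_lift_base presentation_hom_pi.
by rewrite [LHS]linearize_base normal_treeK.
Qed.

Lemma presentation_homK n : cancel (presentation_hom n) (@presentation_inv n).
Proof.
move=> q; have [x ->] := quot_pi_surj q.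
rewrite presentation_hom_pi; move: x.
apply: (@lin_ext K (tree_operad _) n _
  (fun x => presentation_inv (eval_hom g K n x)) (@quot_pi K F J n))
  => [a x y||t].
- by rewrite (@hom_linear _ _ _ (eval_hom g K)) /presentation_inv lin_lift_linear.
- exact: (@quot_pi_linear K F J n).
- rewrite [eval_hom g K n _]linearize_base /presentation_inv lin_lift_base.
  exact: pi_normal_tree.
Qed.

Lemma presentation_hom_gen (s : dias_symbol g) :
  presentation_hom 1%N (quot_pi J (free_gen K s)) = dias_gen K s.
Proof. by rewrite presentation_hom_pi; exact: eval_hom_gen. Qed.

End Presentation.

(** * The primed generators as a basis in arity 2 *)

Section PrimedBasis.
Variables (K : fieldType) (g : nat).

Local Notation V := (lin K (tree_operad (dias_symbol g)) 1%N).
Local Notation G := ([seq primed K s | s <- enum (dias_symbol g)] : seq V).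

Lemma corolla_inj (S : finType) : injective (@corolla S).
Proof. by move=> s s' /(congr1 val) []. Qed.

Lemma ntree1P (S : finType) (t : ntree S 1) : exists s, t = corolla s.
Proof.
case: t => -[|s [|a l r] [|a' l' r']] //= tP; have := eqP tP.
- by exists s; apply: val_inj.
- by have := leaves_gt0 l'; have := leaves_gt0 r'; lia.
- by have := leaves_gt0 l; have := leaves_gt0 r; lia.
- by have := leaves_gt0 l; have := leaves_gt0 r; have := leaves_gt0 l'; lia.
Qed.

Lemma primed_in_span s : (primed K s : V) \in <<G>>%VS.
Proof. by apply/memv_span/map_f; rewrite mem_enum. Qed.

Lemma gen_in_span (s : dias_symbol g) : (free_gen K s : V) \in <<G>>%VS.
Proof.
(* Left and right generators are treated alike: each is the telescoping sum of primed ones of index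
   at least its own. *)
have tele (f p : 'I_g -> V) : (forall a, p a \in <<G>>%VS) ->
    (forall a, p a = if insub a.+1 is Some b then f a - f b else f a) ->
    forall a, f a \in <<G>>%VS.
  move=> pG pE a; have pE' (b : 'I_g) : p b = ext0 f b - ext0 f b.+1.
    by rewrite pE ext0_ord /ext0; case: insub => //; rewrite subr0.
  rewrite -(ext0_ord f) -(@sum_telescope_out g _ (ext0 f) a) ?ext0_out //.
    by apply: memv_suml => b _; rewrite -pE'.
  exact: ltnW.
case: s => a.
- refine (tele (fun b => free_gen K (inl b : dias_symbol g)) (@lp K g) _ _ a) => b.
    exact: (primed_in_span (inl b)).
  by [].
- refine (tele (fun b => free_gen K (inr b : dias_symbol g)) (@rp K g) _ _ a) => b.
    exact: (primed_in_span (inr b)).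
  by [].
Qed.

Lemma primed_basis : basis_of fullv G.
Proof.
rewrite basisEdim; apply/andP; split.
  apply/subvP => x _; rewrite (lin_baseE x); apply: memv_suml => t _.
  apply: memvZ; have [s ->] := ntree1P t; exact: gen_in_span.
(* A spanning family no longer than the dimension is a basis. The dimension counts the trees with
   two leaves, and corollas of distinct symbols are distinct. *)
rewrite size_map -cardE dimvf.
have -> : dim V = #|{: tree_operad (dias_symbol g) 1%N}| by exact: muln1.
exact: leq_card (@corolla_inj _).
Qed.

End PrimedBasis.

Theorem proposition2p3p8 (K : fieldType) (charK0 : [pchar K]%R =i pred0)
    (g : nat) :
  admits_presentation (@dias_gen K g)
    [seq primed K s | s <- enum (dias_symbol g)] (@primed_relator K g).
Proof.
split; first exact: primed_basis.
exists (presentation_hom K g); split; last exact: presentation_hom_gen.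
move=> n; exists (@presentation_inv K g n).
- exact: presentation_homK.
- exact: presentation_invK.
Qed.
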